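(* In the increasing-batch setting of the context, assume (E.1) and (E.2), and assume that the number of samples $n(k)$ at iteration $k$ is lower bounded by $\big(\gamma_k/\zeta(\gamma_k)\big)^2$, i.e. for some $\alpha>0$, $n(k)\ge\alpha\big(\gamma_k/\zeta(\gamma_k)\big)^2$. Then the summability condition on the gradient error is satisfied; namely, the sequence $\big(\gamma_{k+1}\mathbb E[\|\lambda_{k+1}\|\mid\mathcal S_k]\big)_{k\in\mathbb N}$ belongs to $\ell^1(\mathfrak S)$, i.e. it is adapted to the filtration $\mathfrak S$ and almost surely summable.
   Context: **Problem.** $\mathcal H$ is a real Hilbert space, $\mathcal C\subset\mathcal H$ is convex and weakly compact, $A$ is a bounded linear operator from $\mathcal H$ to a real Hilbert space, $b\in\operatorname{ran}A$, $\eta$ is a random variable, and the problem is $\min_{x\in\mathcal C,\ Ax=b} f(x)$ with $f(x)=\mathbb E[L(x,\eta)]$, where $L(\cdot,\eta)$ is differentiable for every $\eta$. **$\omega$-smoothness.** Given $\omega:[0,\infty[\to[0,\infty[$ with $\omega(0)=0$ and $s\mapsto\int_0^1\omega(st)\,dt$ nondecreasing, a differentiable function $\varphi$ is $\omega$-smooth if $\|\nabla\varphi(x)-\nabla\varphi(y)\|\le\omega(\|x-y\|)$ for all $x,y$. (E.1) $\nabla f(x)=\mathbb E[\nabla_xL(x,\eta)]$ (almost surely). (E.2) For all $\eta$, the function $L(\cdot,\eta)$ is $\omega$-smooth with $\omega$ nondecreasing. **Iteration (ICGALP for this problem).** With $x_0\in\mathcal C$, $\mu_0\in\operatorname{ran}A$,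 $z_k=\widehat\nabla f_k+A^*\mu_k+\rho_kA^*(Ax_k-b)$, $\widehat s_k\in\mathcal C$ a (possibly inexact, up to error $\lambda_k^s\ge0$) minimizer of $\langle z_k,\cdot\rangle$ over $\mathcal C$, $x_{k+1}=x_k-\gamma_k(x_k-\widehat s_k)$, $\mu_{k+1}=\mu_k+\theta_k(Ax_{k+1}-b)$, where $\gamma_k\in]0,1]$ and $\rho_k,\theta_k\ge0$. Filtration: $\mathfrak S=(\mathcal S_k)_{k\in\mathbb N}$, $\mathcal S_k=\sigma(x_0,\mu_0,\widehat s_0,\dots,\widehat s_k)$. The gradient is computed inexactly by $$\widehat\nabla f_k=\frac1{n(k)}\sum_{i=1}^{n(k)}\nabla_xL(x_k,\eta_i),$$ where $n(k)$ is the number of samples taken at iteration $k$ (a function of $k$) and the $\eta_i$ are i.i.d. according to some fixed distribution (that of $\eta$). The gradient error is $\lambda_k=\widehat\nabla f_k-\nabla f(x_k)$. **Step sizes.** $\zeta:]0,1]\to[0,\infty[$ is the function from the $(F,\zeta)$-smoothness of $(f,\mathcal C)$, i.e.: there are a function $F$ and an open set $\mathcal C_0$ with $\mathcal C\subset\mathcal C_0\subset\operatorname{int}\operatorname{dom}F$, such that $F,f$ are differentiable on $\mathcal C_0$, $F-f$ is convex on $\mathcal C_0$, and $\sup\{(F(z)-F(x)-\langle\nabla F(x),z-x\rangle)/\zeta(\gamma): x,s\in\mathcal C,\ \gamma\in]0,1],\ z=x+\gamma(s-x)\}<\infty$. The step sizes satisfy $\sum_k\zeta(\gamma_k)<\i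nfty$.
   Formalization: Adds that E‖∇_xL(c,η)‖² is finite for some c in C (the claim fails for η of infinite variance); the samples of each iteration are fresh, independent of the past, and random vectors are Borel measurable with separable range. *)

(* Defs.v *)
From HB Require Import structures.
From mathcomp Require Import all_boot all_order all_algebra.
From mathcomp Require Import sesquilinear.
From mathcomp Require Import all_classical all_reals all_analysis.

Set Implicit Arguments.
Unset Strict Implicit.
Unset Printing Implicit Defensive.

Import Order.TTheory GRing.Theory Num.Theory.
Import numFieldNormedType.Exports.

Local Open Scope classical_set_scope.
Local Open Scope ring_scope.

Section hilbert.
Context {R : realType} {H : completeNormedModType R}.
Implicit Type ip : {dot H for idfun}.

(* A real Hilbert space is a complete normed module whose norm comes from an
   inner product [ip]. *)
Definition norm_of_ip ip := forall x : H, ip x x = `|x| ^+ 2.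

(* The weak topology is the initial one for the functionals [ip x ^~], x in H,
   that is, the one pulled back from the product topology of H -> R. *)
Definition weakly_compact ip (C : set H) :=
  compact (C : set (initial_topology
    (fun x : H => ((fun h => ip x h) : {ptws H -> R^o})))).

(* Frechet differentiability at x, with v the Riesz representative of the
   differential. *)
Definition is_gradient ip (phi : H -> R^o) (x v : H) :=
  differentiable phi x /\ forall h, 'd phi x h = ip v h.

Definition omega_smooth ip (omega : R -> R) (phi : H -> R) (g : H -> H) :=
  (forall x, is_gradient ip phi x (g x)) /\
  (forall x y, `|g x - g y| <= omega `|x - y|).

(* [gradf] is the gradient of f on the open set C0. Extended division is used
   in the supremum, so that a positive numerator over [zeta gam = 0] is +oo.
   C0 need not be convex: convexity of F - f on C0 is convexity on each convex
   part of C0. *)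
Definition Fzeta_smooth ip (C : set H) (f : H -> R) (gradf : H -> H)
    (zeta : R -> R) :=
  exists (F : H -> \bar R) (gradF : H -> H) (C0 : set H),
  [/\ forall x, F x != -oo%E,
      [/\ open C0, C `<=` C0 & C0 `<=` [set x | (F x < +oo)%E]°],
      forall x, C0 x -> is_gradient ip (fun y => fine (F y)) x (gradF x) /\
                        is_gradient ip f x (gradf x),
      forall D : set H, D `<=` C0 -> convex_set D ->
        convex_function D (fun x => fine (F x) - f x) &
      (ereal_sup [set r : \bar R | exists x s z : H, exists gam : R,
         [/\ C x, C s, (0 < gam <= 1)%R, z = (x + gam *: (s - x))%R &
             r = (fine (F z) - fine (F x) - ip (gradF x) (z - x))%R%:E
                 / (zeta gam)%:E]] < +oo)%E].

End hilbert.

Definition smoothness_modulus {R : realType} (omega : R -> R) :=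
  [/\ omega 0 = 0,
      forall s, 0 <= s -> 0 <= omega s &
      forall s s', 0 <= s -> s <= s' ->
        (\int[lebesgue_measure]_(t in `[0%R, 1%R]) (omega (s * t))%:E <=
         \int[lebesgue_measure]_(t in `[0%R, 1%R]) (omega (s' * t))%:E)%E].

Section random_vectors.
Context {R : realType} {H : completeNormedModType R}.

(* A random vector is Borel measurable with separable range; in a separable H
   the second condition is void. Without it, sums of Borel measurable
   H-valued maps may fail to be measurable. *)
Definition random_vector {d} {T : measurableType d} (X : T -> H) :=
  (forall U : set H, open U -> measurable (X @^-1` U)) /\
  (exists2 D : set H, countable D & range X `<=` closure D).

Definition simple_vector {d} {T : measurableType d} (s : T -> H) :=
  finite_set (range s) /\ forall y, measurable (s @^-1` [set y]).

Definition simple_mean {d} {T : measurableType d} (P : probability T R)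
    (s : T -> H) : H :=
  \sum_(y \in range s) fine (P (s @^-1` [set y])) *: y.

(* E[X] = v as a Bochner integral. *)
Definition is_bochner_mean {d} {T : measurableType d} (P : probability T R)
    (X : T -> H) (v : H) :=
  random_vector X /\
  exists s : nat -> T -> H,
  [/\ forall m, simple_vector (s m),
      (fun m => 'E_P[fun w => `|X w - s m w|%R]%E) @ \oo --> 0%E &
      (fun m => simple_mean P (s m)) @ \oo --> v].

End random_vectors.

Section probability.
Context {R : realType} {d} {T : measurableType d} (P : probability T R).

Definition mutually_independent (I : eqType) (G : I -> set (set T)) :=
  forall (J : seq I) (B : I -> set T), uniq J ->
    (forall i, i \in J -> G i (B i)) ->
    P (\bigcap_(i in [set` J]) B i) = (\prod_(i <- J) P (B i))%E.

Definition independent2 (G1 G2 : set (set T)) :=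
  forall B1 B2, G1 B1 -> G2 B2 -> P (B1 `&` B2) = (P B1 * P B2)%E.

Definition measurable_wrt (G : set (set T)) (Y : T -> R) :=
  forall B : set R, measurable B -> G (Y @^-1` B).

(* Y is a version of E[X | G]. *)
Definition is_cond_expectation (G : set (set T)) (X Y : T -> R) :=
  [/\ P.-integrable setT (EFin \o X),
      P.-integrable setT (EFin \o Y),
      measurable_wrt G Y &
      forall B, G B -> (\int[P]_(w in B) (Y w)%:E = \int[P]_(w in B) (X w)%:E)%E].

Definition in_l1 (S : nat -> set (set T)) (r : nat -> T -> R) :=
  (forall k, measurable_wrt (S k) (r k)) /\
  {ae P, forall w, cvgn (series (fun k => `|r k w|))}.

End probability.

(* sigma(x0, mu0, s 0, ..., s k) *)
Definition history {R : realType} {H G : completeNormedModType R}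
    {d} {T : measurableType d}
    (x0 : T -> H) (mu0 : T -> G) (s : nat -> T -> H) (k : nat) : set (set T) :=
  <<s preimage_set_system setT x0 open `|`
      preimage_set_system setT mu0 open `|`
      \bigcup_(i in `I_k.+1) preimage_set_system setT (s i) open >>.

(* sigma(X 0, ..., X (n - 1)) *)
Definition batch_sigma {d} {T : measurableType d} {d'} {E : measurableType d'}
    (n : nat) (X : 'I_n -> T -> E) : set (set T) :=
  <<s \bigcup_i preimage_set_system setT (X i) measurable >>.

(* Main.v *)
Require Import Defs.
From HB Require Import structures.
From mathcomp Require Import all_boot all_order all_algebra.
From mathcomp Require Import sesquilinear.
From mathcomp Require Import all_classical all_reals all_analysis.
From mathcomp Require Import measurable_realfun ring lra.

Import Order.TTheory GRing.Theory Num.Theory.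
Import numFieldNormedType.Exports.

Local Open Scope classical_set_scope.
Local Open Scope ring_scope.

(** Write [G_i] for the difference between the gradient of the loss at sample
    [i] of iteration [k.+1] and [gradf], both taken at the iterate [x k.+1].
    The iterate is a function of the past [S k], the samples are independent of
    the past, and each [G_i] has mean zero for every frozen value of the
    iterate.  Hence distinct [G_i] are orthogonal in mean square, even after
    restriction to an event [B] of the past, and the average of [n] of them
    satisfies the variance estimate: the integral of its squared norm over [B]
    is at most [M / n * P B].  Here [M] bounds the second moments: [C] is
    bounded, being weakly compact, so omega-smoothness dominates every [|G_i|]
    by a single square-integrable function of the sample.

    Since [|v| <= t / 2 + |v|^2 / (2 t)], the integral over [B] of the norm of
    the error is at most [t * P B] as soon as [M / n <= t ^ 2], and letting [B]
    run through the past shows that [E[|lam k.+1| | S k]] lies in [[0, t]]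
    almost surely.  The lower bound on the batch size allows [t = K * zeta /
    gamma] for a constant [K]; after multiplication by [gamma] the terms are
    bounded by [K * zeta], which is summable.

    Three points require care.

    - [H] is not assumed separable and the gradient of the loss is not assumed
      continuous in the point, so it need not be jointly measurable in the
      point and the sample.  The loss itself is measurable in the sample and
      continuous in the point, and the inner product of its gradient with a
      fixed direction is a limit of difference quotients; this gives joint
      measurability of these inner products ([partial_gradient_measurable]),
      which is enough for Fubini's theorem, one direction at a time
      ([mean_zero_pair]).

    - The errors have a separable range, so Gram-Schmidt orthonormalization of
      a dense sequence gives countably many directions for which Parseval's
      identity holds ([parseval]).  Summing the scalar orthogonality relations
      over these directions gives the variance estimate ([variance_bound]).

    - Conditional expectations are produced by the Radon-Nikodym theorem on the
      space equipped with the smaller sigma-algebra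
      ([cond_expectation_exists]), and bounded by testing them on the events
      where they leave [[0, t]] ([cond_expectation_bounded]). *)

(** * Inner products and Gram-Schmidt orthonormalization *)

Section inner_product.
Context {R : realType} {H : completeNormedModType R} (ip : {dot H for idfun}).
Hypothesis Hip : norm_of_ip ip.

Lemma ipC x y : ip x y = ip y x.
Proof. by have := hermC ip x y; rewrite /= expr0 mul1r. Qed.

Lemma ipDl x y z : ip (x + y) z = ip x z + ip y z.
Proof. exact: linearDl. Qed.

Lemma ipBl x y z : ip (x - y) z = ip x z - ip y z.
Proof. exact: linearBl. Qed.

Lemma ipZl a x y : ip (a *: x) y = a * ip x y.
Proof. exact: linearZl_LR. Qed.

Lemma ip0l x : ip 0 x = 0.
Proof. exact: linear0l. Qed.

Lemma ipDr x y z : ip z (x + y) = ip z x + ip z y.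
Proof. by rewrite ipC ipDl ipC [ip y z]ipC. Qed.

Lemma ipZr a x y : ip x (a *: y) = a * ip x y.
Proof. by rewrite ipC ipZl ipC. Qed.

Lemma ip_normB x y : `|x - y| ^+ 2 = `|x| ^+ 2 - ip x y *+ 2 + `|y| ^+ 2.
Proof.
by rewrite -!Hip ipBl 2!(ipC _ (x - y)) !ipBl [ip y x]ipC; ring.
Qed.

Lemma ip_cauchy_schwarz x y : `|ip x y| <= `|x| * `|y|.
Proof.
have [->|x0] := eqVneq x 0; first by rewrite ip0l !normr0 mul0r.
have [->|y0] := eqVneq y 0; first by rewrite ipC ip0l !normr0 mulr0.
have nx : 0 < `|x| by rewrite normr_gt0.
have ny : 0 < `|y| by rewrite normr_gt0.
have key u v : `|u| = 1 -> `|v| = 1 -> ip u v <= 1.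
  move=> u1 v1; have := sqr_ge0 `|u - v|; rewrite ip_normB u1 v1; lra.
have unit (v : H) (v0 : 0 < `|v|) : `| `|v|^-1 *: v| = 1.
  by rewrite normrZ ger0_norm ?invr_ge0 ?ltW // mulVf // gt_eqF.
have eqxy : ip x y = `|x| * `|y| * ip (`|x|^-1 *: x) (`|y|^-1 *: y).
  by rewrite ipZl ipZr; field; rewrite !gt_eqF.
rewrite eqxy !normrM !normr_id ler_piMr ?mulr_ge0 //.
rewrite ler_norml key ?unit // andbT lerNl -mulN1r -ipZl scaleN1r.
by rewrite key ?normrN ?unit.
Qed.

Lemma ip_continuousl h : continuous (fun v => ip v h : R^o).
Proof.
move=> v; apply/cvgrPdist_lt => e e0; near=> u.
rewrite -ipBl (le_lt_trans (ip_cauchy_schwarz _ _)) //.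
rewrite (@le_lt_trans _ _ (`|v - u| * (`|h| + 1))) ?ler_wpM2l ?lerDl //.
rewrite -ltr_pdivlMr ?ltr_pwDr //.
near: u; apply: (@cvgr_dist_lt _ _ _ (nbhs v) _ id v); first exact: cvg_id.
by rewrite divr_gt0 // ltr_pwDr.
Unshelve. all: by end_near. Qed.

(** The orthogonal projection on the span of [d 0, ..., d (N - 1)], computed
    along with the orthonormal directions: each step adds the component along
    the normalized residual of [d m].  When [d m] depends on its predecessors
    the residual is [0], and since [0^-1 = 0] its direction is [0] as well. *)
Fixpoint gram_schmidt (d : nat -> H) (N : nat) (v : H) : H :=
  if N is m.+1 then
    let r := d m - gram_schmidt d m (d m) in
    let u := `|r|^-1 *: r in
    gram_schmidt d m v + ip v u *: u
  else 0.

Definition gs_dir (d : nat -> H) (m : nat) : H :=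
  let r := d m - gram_schmidt d m (d m) in `|r|^-1 *: r.

Section gram_schmidt.
Variable d : nat -> H.
Local Notation p := (gram_schmidt d).
Local Notation e := (gs_dir d).

Lemma gram_schmidtS N v : p N.+1 v = p N v + ip v (e N) *: e N.
Proof. by []. Qed.

Lemma gram_schmidtD N v w : p N (v + w) = p N v + p N w.
Proof.
elim: N => [|N IH]; first by rewrite addr0.
by rewrite !gram_schmidtS IH ipDl scalerDl addrACA.
Qed.

Lemma gram_schmidtZ N a v : p N (a *: v) = a *: p N v.
Proof.
elim: N => [|N IH]; first by rewrite scaler0.
by rewrite !gram_schmidtS IH (ipZl a v) -scalerA scalerDr.
Qed.

Lemma gram_schmidtB N v w : p N (v - w) = p N v - p N w.
Proof. by rewrite gram_schmidtD -scaleN1r gram_schmidtZ scaleN1r. Qed.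

Lemma gram_schmidt_sym N v w : ip (p N v) w = ip v (p N w).
Proof.
elim: N => [|N IH]; first by rewrite [ip v _]ipC !ip0l.
rewrite !gram_schmidtS ipDl ipDr IH (ipZl _ (e N)) (ipZr _ v (e N)).
rewrite (ipC (e N) w).
by rewrite [ip w _ * _]mulrC.
Qed.

(** Each direction is a unit vector or [0]; this covers both cases. *)
Lemma gs_dir_norm m : ip (e m) (e m) *: e m = e m.
Proof.
rewrite Hip /gs_dir; set r := (_ - _).
have [->|r0] := eqVneq r 0; first by rewrite !scaler0.
by rewrite normrZ ger0_norm ?invr_ge0 // mulVf ?normr_eq0 // expr1n scale1r.
Qed.

Lemma gs_dir_norm_le1 m : `|e m| <= 1.
Proof.
rewrite /gs_dir; set r := (_ - _).
have [->|r0] := eqVneq r 0; first by rewrite scaler0 normr0.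
by rewrite normrZ ger0_norm ?invr_ge0 // mulVf // normr_eq0.
Qed.

(** Idempotence at rank [N] makes the projection kill the next residual, hence
    the next direction; this orthogonality in turn gives idempotence at rank
    [N.+1].  The two facts are therefore proved by one induction. *)
Lemma gram_schmidt_dir_idem N :
  (forall v, p N (p N v) = p N v) * (p N (e N) = 0).
Proof.
elim: N => [|N [idN eN]]; first by split=> //=; rewrite /gs_dir /= subr0.
have id v : p N.+1 (p N.+1 v) = p N.+1 v.
  rewrite !gram_schmidtS gram_schmidtD gram_schmidtZ idN eN scaler0 addr0.
  rewrite ipDl gram_schmidt_sym eN [ip v 0]ipC ip0l add0r (ipZl _ (e N)).
  rewrite -scalerA.
  by rewrite gs_dir_norm.
by split=> //; rewrite /gs_dir gram_schmidtZ gram_schmidtB id subrr scaler0.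
Qed.

Lemma gram_schmidt_idem N v : p N (p N v) = p N v.
Proof. by rewrite gram_schmidt_dir_idem. Qed.

Lemma gram_schmidt_ip_dir N v : ip (p N v) (e N) = 0.
Proof. by rewrite gram_schmidt_sym gram_schmidt_dir_idem ipC ip0l. Qed.

(** By symmetry and idempotence, [ip v (p N v)] is the squared norm of the
    projection. *)
Lemma bessel_eq N v : `|v - p N v| ^+ 2 = `|v| ^+ 2 - ip v (p N v).
Proof.
by rewrite ip_normB -(Hip (p N v)) gram_schmidt_sym gram_schmidt_idem; ring.
Qed.

Lemma ip_gram_schmidt N v : ip v (p N v) = \sum_(l < N) ip v (e l) ^+ 2.
Proof.
elim: N => [|N IH]; first by rewrite ipC ip0l big_ord0.
by rewrite gram_schmidtS ipDr big_ord_recr -IH (ipZr _ v (e N)) expr2.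
Qed.

Lemma bessel N v : \sum_(l < N) ip v (e l) ^+ 2 <= `|v| ^+ 2.
Proof. by rewrite -ip_gram_schmidt -subr_ge0 -bessel_eq sqr_ge0. Qed.

Lemma norm_sub_gram_schmidt N v : `|v - p N v| <= `|v|.
Proof.
rewrite -(@ler_pXn2r _ 2) ?nnegrE // bessel_eq gerBl ip_gram_schmidt.
by apply: sumr_ge0 => i _; exact: sqr_ge0.
Qed.

Lemma gram_schmidt_fix N m : (m < N)%N -> p N (d m) = d m.
Proof.
elim: N => [//|N IH]; rewrite ltnS leq_eqVlt => /orP[/eqP->|mN]; last first.
  by rewrite gram_schmidtS -{2}(IH mN) gram_schmidt_ip_dir scale0r addr0 IH.
have -> : p N.+1 (d N) = p N (d N) + ip (d N - p N (d N)) (e N) *: e N.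
  by rewrite gram_schmidtS ipBl gram_schmidt_ip_dir subr0.
rewrite /gs_dir; set r := d N - _.
have [r0|r0] := eqVneq r 0.
  by rewrite r0 !scaler0 addr0; apply/esym/eqP; rewrite -subr_eq0 -/r r0.
rewrite ipZr Hip scalerA expr2 mulrA mulVf ?normr_eq0 // mul1r.
by rewrite mulfV ?normr_eq0 // scale1r addrC subrK.
Qed.

(** Projections are contractions fixing [d m] from rank [m.+1] on, so the
    distance from [v] to its projection is eventually at most the distance from
    [v] to [d m]. *)
Lemma gram_schmidt_cvg v : closure (range d) v -> p ^~ v @ \oo --> v.
Proof.
move=> cv; apply/cvgrPdist_lt => eps eps0.
have [_ [[m _ <-] /= vm]] : (range d `&` ball v eps) !=set0.
  exact: cv (nbhsx_ballx v eps eps0).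
near=> N.
have mN : (m < N)%N by near: N; exact: nbhs_infty_gt.
have -> : v - p N v = (v - d m) - p N (v - d m).
  by rewrite gram_schmidtB gram_schmidt_fix // opprB addrA subrK.
rewrite (le_lt_trans (norm_sub_gram_schmidt _ _)) //.
by move: vm; rewrite -ball_normE.
Unshelve. all: by end_near. Qed.

(** Stated under convergence of the projections of [v], a condition stable
    under sums, so that it applies to combinations of vectors in the closure of
    the range of [d]. *)
Lemma parseval v : p ^~ v @ \oo --> v ->
  (fun N => \sum_(l < N) ip v (e l) ^+ 2) @ \oo --> `|v| ^+ 2.
Proof.
move=> pv; under eq_fun do rewrite -ip_gram_schmidt ipC.
by rewrite -Hip; apply: (continuous_cvg _ (ip_continuousl v v) pv).
Qed.

End gram_schmidt.

End inner_product.

(** * Weakly compact sets and gradients *)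

Section weakly_compact.
Context {R : realType} {H : completeNormedModType R} (ip : {dot H for idfun}).
Hypothesis Hip : norm_of_ip ip.

(** Each functional [ip x], for [x] in [C], is continuous, and weak compactness
    bounds this family pointwise; by the uniform boundedness principle it is
    bounded on the unit ball, where its supremum is the norm of [x]. *)
Lemma weakly_compact_bounded (C : set H) : weakly_compact ip C ->
  exists M, forall x, C x -> `|x| <= M.
Proof.
move=> cC.
pose W := initial_topology
  (fun x : H => ((fun h => ip x h) : {ptws H -> R^o})).
have ptb h : exists M, forall x, C x -> `|ip x h| <= M.
  have cont : continuous (fun x : W => ip x h : R^o).
    move=> x.
    apply: (@continuous_comp W {ptws H -> R^o} R^o
      (fun x : H => ((fun h => ip x h) : {ptws H -> R^o})) (fun g => g h)).
      exact: initial_continuous.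
    exact: (@proj_continuous H (fun=> R^o) h).
  have /compact_bounded [M [_ HM]] : compact ((fun x : H => ip x h : R^o) @` C).
    exact: (@continuous_compact W R^o _ C (continuous_subspaceT cont) cC).
  exists (M + 1) => x Cx; have M1 : M < M + 1 by rewrite ltrDl.
  by have := HM _ M1; apply; exists x.
have [||M HM] := @Banach_Steinhauss R H R^o
  [set (fun h => ip x h : R^o) | x in C] _ _ 1.
- move=> _ [x Cx <-]; split; last first.
    by move=> a u v; rewrite (ipDr ip) (ipZr ip).
  move=> r; exists (`|x| * r) => y yr.
  by rewrite (le_trans (ip_cauchy_schwarz ip Hip x y)) // ler_wpM2l.
- by move=> h; have [M HM] := ptb h; exists M => _ [x Cx <-]; exact: HM.
exists M => x Cx.
have [x0|x0] := eqVneq x 0.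
  have := HM _ (ex_intro2 _ _ x Cx erefl) 0.
  by rewrite x0 !normr0 => /(_ ler01); exact: le_trans.
have nx : 0 < `|x| by rewrite normr_gt0.
have := HM _ (ex_intro2 _ _ x Cx erefl) (`|x|^-1 *: x).
rewrite normrZ ger0_norm ?invr_ge0 // mulVf ?gt_eqF // => /(_ (lexx _)).
rewrite (ipZr ip) Hip expr2 mulrA mulVf ?gt_eqF // mul1r.
by rewrite ger0_norm.
Qed.

(** Only the values of [phi] occur in the sequence: measurability in a
    parameter therefore passes from a function to its gradient, in each
    direction. *)
Lemma gradient_quotient_cvg (phi : H -> R^o) (x v h : H) :
  is_gradient ip phi x v ->
  (fun m : nat => m.+1%:R * (phi (x + m.+1%:R^-1 *: h) - phi x)) @ \oo
    --> ip v h.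
Proof.
move=> [dphi gE].
have cvgD : derivable phi x h by exact: diff_derivable.
have Dlim : (fun a : R => a^-1 *: ((phi \o shift x) (a *: h) - phi x)) @ 0^'
    --> ip v h.
  by rewrite -gE -deriveE.
have hseq : (forall m : nat, m.+1%:R^-1 != 0 :> R) /\
    (fun m : nat => m.+1%:R^-1 : R) @ \oo --> (0 : R).
  by split=> [m|]; [rewrite invr_neq0 // pnatr_eq0 | exact: cvg_harmonic].
have := (cvgr_dnbhsP _ _ _).1 Dlim _ hseq.
by under eq_fun do rewrite /= invrK [_ *: h + x]addrC.
Qed.
End weakly_compact.

(** * Strong measurability *)

(** Uniform approximation by countably-valued measurable maps.  Unlike Borel
    measurability this is stable under sums without separability of [H]. *)
Definition strongly_measurable {R : realType} {H : completeNormedModType R}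
    {d} {T : measurableType d} (X : T -> H) :=
  forall eps, 0 < eps -> exists (D : nat -> H) (N : T -> nat),
    (forall m, measurable (N @^-1` [set m])) /\
    forall w, `|X w - D (N w)| < eps.

Section strongly_measurable.
Context {R : realType} {H : completeNormedModType R}.

Lemma countable_sub_range (D : set H) : countable D ->
  exists g : nat -> H, D `<=` range g.
Proof.
move=> /countable_injP[f finj].
exists (fun m => xget 0 [set y | D y /\ f y = m]) => y Dy.
exists (f y) => //; set S := [set _ | _].
have [Dz fz] : S (xget 0 S) by apply: (@xgetI _ 0 S y).
by apply: finj; rewrite ?inE.
Qed.

Context {d} {T : measurableType d}.
Implicit Types X Y : T -> H.

(** The sets need not be disjoint: choosing at each point the first one
    containing it is a measurable selection. *)
Lemma strongly_measurable_cover X :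
  (forall eps, 0 < eps -> exists (D : nat -> H) (A : nat -> set T),
    [/\ forall m, measurable (A m), forall w, exists m, A m w &
        forall m w, A m w -> `|X w - D m| < eps]) ->
  strongly_measurable X.
Proof.
move=> cov eps eps0; have [D [A [mA Acov AD]]] := cov _ eps0.
have exA w : exists m, `[< A m w >].
  by have [m Am] := Acov w; exists m; apply/asboolP.
exists D, (fun w => ex_minn (exA w)); split=> [m|w]; last first.
  by case: ex_minnP => m /asboolP Am _; exact: AD.
have -> : (fun w => ex_minn (exA w)) @^-1` [set m] =
    A m `&` \bigcap_(i in `I_m) ~` A i.
  apply/seteqP; split=> w /=.
    case: ex_minnP => l /asboolP Al lmin <-; split=> // i /= il Ai.
    by move: (lmin i); rewrite leqNgt il => /(_ (asboolT Ai)).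
  move=> [Am Ai]; case: ex_minnP => l /asboolP Al lmin.
  apply/eqP; rewrite eqn_leq lmin ?andbT; last exact/asboolP.
  by rewrite leqNgt; apply/negP => lm; exact: (Ai l).
apply: measurableI => //; apply: bigcap_measurableType => // i _.
exact: measurableC.
Qed.

(** The balls around a countable dense family cover the range. *)
Lemma random_vector_strongly_measurable X :
  random_vector X -> strongly_measurable X.
Proof.
move=> [mX [D /countable_sub_range[g Dg] XD]]; apply: strongly_measurable_cover.
move=> eps eps0; exists g, (fun m => X @^-1` ball (g m) eps).
split=> [m|w|m w /=]; first exact/mX/ball_open.
  have [y [Dy]] : (D `&` ball (X w) eps) !=set0.
    by apply: XD; [exists w|exact: nbhsx_ballx].
  by have [m _ <-] := Dg _ Dy; exists m; exact: ball_sym.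
by rewrite -ball_normE /= distrC.
Qed.

Lemma strongly_measurableD X Y :
  strongly_measurable X -> strongly_measurable Y ->
  strongly_measurable (fun w => X w + Y w).
Proof.
move=> sX sY; apply: strongly_measurable_cover => eps eps0.
have eps2 : 0 < eps / 2 by rewrite divr_gt0.
have [D [N [mN XN]]] := sX _ eps2; have [D' [N' [mN' YN']]] := sY _ eps2.
exists (fun m => if unpickle m is Some (a, b) then D a + D' b else 0),
  (fun m => if unpickle m is Some (a, b)
            then N @^-1` [set a] `&` N' @^-1` [set b] else set0).
split=> [m|w|m w].
- by case: unpickle => [[a b]|//]; exact: measurableI.
- by exists (pickle (N w, N' w)); rewrite pickleK.
- case: unpickle => [[a b] [/= <- <-]|//].
  rewrite opprD addrACA (le_lt_trans (ler_normD _ _)) //.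
  by rewrite (splitr eps) ltrD.
Qed.

Lemma strongly_measurableZ (a : R) X :
  strongly_measurable X -> strongly_measurable (fun w => a *: X w).
Proof.
move=> sX eps eps0.
have a0 : 0 < `|a| + 1 by rewrite ltr_wpDl.
have [D [N [mN XN]]] := sX (eps / (`|a| + 1)) (divr_gt0 eps0 a0).
exists (fun m => a *: D m), N; split=> // w.
rewrite -scalerBr normrZ.
rewrite (@le_lt_trans _ _ ((`|a| + 1) * `|X w - D (N w)|)) //.
  by rewrite ler_wpM2r // lerDl.
by rewrite mulrC -ltr_pdivlMr.
Qed.

Lemma strongly_measurable_sum n (X : 'I_n -> T -> H) :
  (forall i, strongly_measurable (X i)) ->
  strongly_measurable (fun w => \sum_(i < n) X i w).
Proof.
elim: n X => [|n IH] X sX.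
  move=> eps eps0; exists (fun=> 0), (fun=> 0%N).
  split=> [m|w]; last by rewrite big_ord0 subr0 normr0.
  by rewrite preimage_cst; case: ifP.
have -> : (fun w => \sum_(i < n.+1) X i w) =
    (fun w => \sum_(i < n) X (widen_ord (leqnSn n) i) w + X ord_max w).
  by apply/funext => w; rewrite big_ord_recr.
by apply: strongly_measurableD => //; exact: IH.
Qed.

(** When [X] is countably valued the composition is a countable gluing of the
    measurable sections [Phi c]; the general case is a pointwise limit, by
    continuity in the first argument. *)
Lemma caratheodory_measurable {d'} {E : measurableType d'} X
    (Phi : H -> E -> R) : strongly_measurable X ->
  (forall c, measurable_fun setT (Phi c)) ->
  (forall e, continuous (fun c => Phi c e : R^o)) ->
  measurable_fun setT (fun y : T * E => Phi (X y.1) y.2).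
Proof.
move=> sX mPhi cPhi.
have inv0 m : 0 < m.+1%:R^-1 :> R by rewrite invr_gt0.
pose D m := sval (cid (sX _ (inv0 m))).
pose N m := sval (cid (svalP (cid (sX _ (inv0 m))))).
have mN m l : measurable (N m @^-1` [set l]).
  exact: (svalP (cid (svalP (cid (sX _ (inv0 m)))))).1.
have XN m w : `|X w - D m (N m w)| < m.+1%:R^-1.
  exact: (svalP (cid (svalP (cid (sX _ (inv0 m)))))).2.
apply: (@measurable_fun_cvg _ _ _ _
  (fun m (y : T * E) => Phi (D m (N m y.1)) y.2)) => [m|[w e] _ /=].
  move=> _ B mB; rewrite setTI.
  have -> : (fun y : T * E => Phi (D m (N m y.1)) y.2) @^-1` B =
      \bigcup_l ((N m @^-1` [set l]) `*` (Phi (D m l) @^-1` B)).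
    apply/seteqP; split=> [[w e] /= Bwe|[w e] [l _ [/= <-]]//].
    by exists (N m w).
  apply: bigcupT_measurable => l; apply: measurableX => //.
  by rewrite -[X in measurable X]setTI; exact: mPhi.
have DX : (fun m => D m (N m w)) @ \oo --> X w; last first.
  exact: (continuous_cvg _ (cPhi e (X w)) DX).
apply/cvgrPdist_lt => eps eps0; near=> m.
rewrite (lt_trans (XN m w)) //.
near: m; have /cvgrPdist_lt/(_ _ eps0) := @cvg_harmonic R.
apply: filterS => m; rewrite sub0r normrN /harmonic /=.
by rewrite ger0_norm // ltW.
Unshelve. all: by end_near. Qed.

Lemma continuous_strongly_measurable X (phi : H -> R) :
  strongly_measurable X -> continuous (phi : H -> R^o) ->
  measurable_fun setT (phi \o X).
Proof.
move=> sX cphi.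
have mPhi := @caratheodory_measurable _ T X (fun c _ => phi c) sX
  (fun c => measurable_cst _) (fun _ => cphi).
exact: (measurableT_comp mPhi
  (measurable_fun_pair (@measurable_id _ T setT) (@measurable_id _ T setT))).
Qed.

End strongly_measurable.

(** One sequence serves all [i], so that the vectors [X i w] and their sums
    share one system of Gram-Schmidt directions. *)
Lemma strongly_measurable_separable {R : realType} {H : completeNormedModType R}
    {d} {T : measurableType d} n (X : 'I_n -> T -> H) :
  (forall i, strongly_measurable (X i)) ->
  exists D : nat -> H, forall i w, closure (range D) (X i w).
Proof.
move=> sX.
have inv0 m : 0 < m.+1%:R^-1 :> R by rewrite invr_gt0.
pose D i m := sval (cid (sX i _ (inv0 m))).
have XD i m w : exists l, `|X i w - D i m l| < m.+1%:R^-1.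
  by have [N [_ XN]] := svalP (cid (sX i _ (inv0 m))); exists (N w).
exists (fun k => if unpickle k is Some (i, m, l) then D i m l else 0) => i w.
move=> B /nbhs_ballP[eps /= eps0 epsB].
have /cvgrPdist_lt/(_ _ eps0)[m _ /(_ m (leqnn m)) meps] := @cvg_harmonic R.
have [l Xl] := XD i m w.
exists (D i m l); split.
  by exists (pickle (i, m, l)) => //; rewrite pickleK.
apply: epsB; rewrite -ball_normE /=; apply: (lt_trans Xl).
by move: meps; rewrite sub0r normrN /harmonic /= ger0_norm // ltW.
Qed.

(** * Integrals of functions of independent maps *)

Section independent_pair.
Context {R : realType} {d d1 d2} {T : measurableType d}
  {T1 : measurableType d1} {T2 : measurableType d2} (P : probability T R).

Definition pair_map (U : T -> T1) (V : T -> T2) (w : T) : T1 * T2 := (U w, V w).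

Lemma pair_map_measurable (U : {mfun T >-> T1}) (V : {mfun T >-> T2}) :
  measurable_fun setT (pair_map U V).
Proof. exact: measurable_fun_pair. Qed.

HB.instance Definition _ (U : {mfun T >-> T1}) (V : {mfun T >-> T2}) :=
  @isMeasurableFun.Build _ _ _ _ (pair_map U V) (pair_map_measurable U V).

Definition independent_maps (U : T -> T1) (V : T -> T2) :=
  forall A B, measurable A -> measurable B ->
    P (U @^-1` A `&` V @^-1` B) = (P (U @^-1` A) * P (V @^-1` B))%E.

Context (U : {mfun T >-> T1}) (V : {mfun T >-> T2}).
Hypothesis UV : independent_maps U V.

(** Independence says that the two sides agree on rectangles, which determine a
    measure on the product. *)
Lemma independent_lawE X : measurable X ->
  (distribution P U \x distribution P V)%E X = P (pair_map U V @^-1` X).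
Proof.
move=> mX.
by apply: (@product_measure_unique _ _ _ _ _ _ _
  (distribution P (pair_map U V : {mfun T >-> _}))) => // A B mA mB; exact: UV.
Qed.

Context (f : T1 * T2 -> R) (mf : measurable_fun setT f).
Hypothesis intf : P.-integrable setT (fun w => (f (U w, V w))%:E).

Lemma independent_integrable :
  (distribution P U \x distribution P V)%E.-integrable setT (EFin \o f).
Proof.
have mEf : measurable_fun setT (EFin \o f) by exact/measurable_EFinP.
have : (distribution P (pair_map U V : {mfun T >-> _})).-integrable setT
  (EFin \o f).
  apply: integrable_pushforward => //; exact: pair_map_measurable.
move=> /integrableP[_ fin]; apply/integrableP; split=> //.
rewrite (@eq_measure_integral _ _ _ _
  (distribution P (pair_map U V : {mfun T >-> _}))) // => A mA _.
exact: independent_lawE.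
Qed.

(** Fubini's theorem for the joint law: the first map may be frozen while the
    second is integrated out. *)
Lemma independent_integral :
  (\int[P]_w (f (U w, V w))%:E =
   \int[distribution P U]_u \int[distribution P V]_v (f (u, v))%:E)%E.
Proof.
rewrite (integral12_prod_meas1 independent_integrable).
have mEf : measurable_fun setT (EFin \o f) by exact/measurable_EFinP.
rewrite (@eq_measure_integral _ _ _ _
  (distribution P (pair_map U V : {mfun T >-> _}))) => [|A mA _]; last first.
  exact: independent_lawE.
by rewrite integral_distribution.
Qed.

End independent_pair.

(** Since [p * q <= p ^+ 2 + q ^+ 2], square-integrable bounds are enough. *)
Lemma integrable_mul {R : realType} {d} {T : measurableType d}
    (mu : {measure set T -> \bar R}) (X Y p q : T -> R) :
  measurable_fun setT X -> measurable_fun setT Y ->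
  (forall w, `|X w| <= p w) -> (forall w, `|Y w| <= q w) ->
  mu.-integrable setT (fun w => (p w ^+ 2)%:E) ->
  mu.-integrable setT (fun w => (q w ^+ 2)%:E) ->
  mu.-integrable setT (fun w => (X w * Y w)%:E).
Proof.
move=> mX mY Xp Yq ip iq.
apply: (le_integrable _ _ _ (integrableD measurableT ip iq)) => //.
  by apply/measurable_EFinP; exact: measurable_funM.
move=> w _ /=; rewrite lee_fin normrM.
rewrite (@ger0_norm _ (p w ^+ 2 + _)) ?addr_ge0 ?sqr_ge0 //.
rewrite (@le_trans _ _ (p w * q w)) ?ler_pM //.
have := sqr_ge0 (p w - q w); have := sqr_ge0 (p w); have := sqr_ge0 (q w).
rewrite !expr2; lra.
Qed.

Lemma integrable_of_sqr {R : realType} {d} {T : measurableType d}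
    (P : probability T R) (X p : T -> R) :
  measurable_fun setT X -> (forall w, `|X w| <= p w) ->
  P.-integrable setT (fun w => (p w ^+ 2)%:E) ->
  P.-integrable setT (fun w => (X w)%:E).
Proof.
move=> mX Xp ip.
have -> : (fun w => (X w)%:E) = (fun w => (X w * cst 1 w)%:E).
  by apply/funext => w; rewrite mulr1.
apply: (@integrable_mul _ _ _ P X (cst 1) p (cst 1)) => // [w|].
  by rewrite normr1.
by under eq_fun do rewrite expr1n; exact: finite_measure_integrable_cst.
Qed.

Section mean_zero_pair.
Context {R : realType} {d d1 d2} {T : measurableType d}
  {T1 : measurableType d1} {E : measurableType d2} (P : probability T R).
Context (U : {mfun T >-> T1}) (V W : {mfun T >-> E}).
Context (a : T1 * E -> R) (q : E -> R).
Hypothesis ma : measurable_fun setT a.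
Hypothesis aq : forall u e, `|a (u, e)| <= q e.
Hypothesis qV : P.-integrable setT (fun w => (q (V w) ^+ 2)%:E).
Hypothesis qW : P.-integrable setT (fun w => (q (W w) ^+ 2)%:E).
Hypothesis VW : independent_maps P V W.
Hypothesis UVW : independent_maps P U (pair_map V W).
Hypothesis a0 : forall u, (\int[distribution P W]_e (a (u, e))%:E = 0)%E.

Let mV : measurable_fun setT (fun w => a (U w, V w)).
Proof.
by apply: measurableT_comp; [exact: ma|exact: measurable_fun_pair].
Qed.

Let mW : measurable_fun setT (fun w => a (U w, W w)).
Proof.
by apply: measurableT_comp; [exact: ma|exact: measurable_fun_pair].
Qed.

Lemma mean_zero_pair_integrable :
  P.-integrable setT (fun w => (a (U w, V w) * a (U w, W w))%:E).
Proof. by apply: integrable_mul qV qW => // w; exact: aq. Qed.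

(** Freezing [U], then [V], leaves the mean of [a (u, W)], which vanishes.
    This is the orthogonality of errors attached to distinct samples,
    conditionally on [U]. *)
Lemma mean_zero_pair :
  (\int[P]_w (a (U w, V w) * a (U w, W w))%:E = 0)%E.
Proof.
pose f (y : T1 * (E * E)) : R := a (y.1, y.2.1) * a (y.1, y.2.2).
have mf : measurable_fun setT f.
  apply: measurable_funM; apply: (measurableT_comp ma).
    apply: measurable_fun_pair => //.
    exact: (measurableT_comp measurable_fst measurable_snd).
  apply: measurable_fun_pair => //.
  exact: (measurableT_comp measurable_snd measurable_snd).
have := @independent_integral _ _ _ _ _ _ _ P U (pair_map V W) UVW f mf
  mean_zero_pair_integrable.
move=> ->; apply: integral0_eq => u _ /=.
have mau : measurable_fun setT (fun e => a (u, e)).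
  exact: measurable_fun_pair2.
rewrite integral_distribution /f /=; last 2 first.
- apply/measurable_EFinP; apply: measurable_funM.
    exact: (measurableT_comp mau measurable_fst).
  exact: (measurableT_comp mau measurable_snd).
- by apply: integrable_mul qV qW => //; exact: (measurableT_comp mau).
rewrite [LHS](@independent_integral _ _ _ _ _ _ _ P V W VW
  (fun y => a (u, y.1) * a (u, y.2))) /=; last 2 first.
- apply: measurable_funM.
    exact: (measurableT_comp mau measurable_fst).
  exact: (measurableT_comp mau measurable_snd).
- by apply: integrable_mul qV qW => //; exact: (measurableT_comp mau).
apply: integral0_eq => v _.
under eq_integral do rewrite EFinM.
rewrite integralZl // ?a0 ?mule0 //.
apply: integrable_pushforward => //; first exact/measurable_EFinP.
by apply: integrable_of_sqr qW => //; exact: (measurableT_comp mau).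
Qed.

End mean_zero_pair.

(** * Variance of a sum of independent centered vectors *)

Lemma le_integral_nondecreasing {R : realType} {d} {T : measurableType d}
    (mu : {measure set T -> \bar R}) (f_ : nat -> T -> R) (f : T -> R)
    (c : \bar R) :
  (forall N, measurable_fun setT (f_ N)) -> (forall N w, 0 <= f_ N w) ->
  (forall w, nondecreasing_seq (f_ ^~ w)) ->
  (forall w, f_ ^~ w @ \oo --> f w) ->
  (forall N, (\int[mu]_w (f_ N w)%:E <= c)%E) ->
  (\int[mu]_w (f w)%:E <= c)%E.
Proof.
move=> mf f0 ndf cf ic.
have := @cvg_monotone_convergence _ _ _ mu setT measurableT
  (fun N w => (f_ N w)%:E).
move=> /(_ _ _ _)/cvg_lim H.
have -> : (\int[mu]_w (f w)%:E = \int[mu]_w limn (fun N => (f_ N w)%:E))%E.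
  by apply: eq_integral => w _; apply/esym/cvg_lim => //; apply: cvg_EFin;
    [near=> k|exact: cf].
rewrite -H //.
- apply: lime_le; last exact: nearW.
  apply: ereal_nondecreasing_is_cvgn => m k mk; apply: ge0_le_integral => //.
  + by move=> w _; rewrite lee_fin.
  + exact/measurable_EFinP.
  + exact/measurable_EFinP.
  + by move=> w _; rewrite lee_fin; exact: ndf.
- by move=> N; exact/measurable_EFinP.
- by move=> N w _; rewrite lee_fin.
- by move=> w _ m k mk; rewrite lee_fin; exact: ndf.
Unshelve. all: by end_near. Qed.

Lemma integral0_sum {R : realType} {d} {T : measurableType d}
    (mu : {measure set T -> \bar R}) (I : Type) (s : seq I) (Q : pred I)
    (h : I -> T -> R) :
  (forall i, Q i -> mu.-integrable setT (fun w => (h i w)%:E) /\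
     (\int[mu]_w (h i w)%:E = 0)%E) ->
  mu.-integrable setT (fun w => (\sum_(i <- s | Q i) h i w)%:E) /\
  (\int[mu]_w (\sum_(i <- s | Q i) h i w)%:E = 0)%E.
Proof.
move=> hQ; elim: s => [|i s [IHi IH0]].
  under eq_fun do rewrite big_nil.
  by split; [exact: integrable0|rewrite integral0].
case: (boolP (Q i)) => Qi; last first.
  by under eq_fun do rewrite big_cons (negbTE Qi).
have [hi h0] := hQ _ Qi.
under eq_fun do rewrite big_cons Qi EFinD.
split; first exact: integrableD.
by rewrite integralD // h0 IH0 adde0.
Qed.

Section variance_bound.
Context {R : realType} {H : completeNormedModType R} (ip : {dot H for idfun}).
Hypothesis Hip : norm_of_ip ip.
Context {d d1 d2} {T : measurableType d} {T1 : measurableType d1}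
  {E : measurableType d2} (P : probability T R).
Context (U : {mfun T >-> T1}) (n : nat) (V : 'I_n -> {mfun T >-> E}).
Context (G : T1 -> E -> H) (q : E -> R) (M : R).
Hypothesis mG : forall h,
  measurable_fun setT (fun y : T1 * E => ip (G y.1 y.2) h).
Hypothesis Gq : forall u e, `|G u e| <= q e.
Hypothesis mq : measurable_fun setT q.
Hypothesis sG : forall i, strongly_measurable (fun w => G (U w) (V i w)).
Hypothesis qV : forall i, P.-integrable setT (fun w => (q (V i w) ^+ 2)%:E).
Hypothesis qM : forall i, (\int[distribution P (V i)]_e (q e ^+ 2)%:E = M%:E)%E.
Hypothesis G0 : forall i u h,
  (\int[distribution P (V i)]_e (ip (G u e) h)%:E = 0)%E.
Hypothesis UV : forall i, independent_maps P U (V i).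
Hypothesis VV : forall i j, i != j -> independent_maps P (V i) (V j).
Hypothesis UVV : forall i j, i != j ->
  independent_maps P U (pair_map (V i) (V j)).

(** Expand the squared norm along Gram-Schmidt directions.  For each direction
    the cross terms have mean zero by [mean_zero_pair], the indicator of [B]
    being absorbed in the scalar function; by Bessel's inequality the diagonal
    terms add up to at most the sum of the [q (V i) ^+ 2], which are
    independent of the event.  The number of directions tends to infinity by
    monotone convergence. *)
Lemma variance_bound (B : set T1) : measurable B ->
  (\int[P]_w (\1_B (U w) * `|\sum_i G (U w) (V i w)| ^+ 2)%:E <=
   (n%:R * M)%:E * P (U @^-1` B))%E.
Proof.
move=> mB.
have [D DG] := @strongly_measurable_separable _ _ _ _ n _ sG.
pose e := gs_dir ip D.
(* The event is absorbed in a function of the frozen variable. *)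
pose a l (y : T1 * E) := \1_B y.1 * ip (G y.1 y.2) (e l).
have ind01 u : 0 <= (\1_B u : R) <= 1.
  by rewrite indicE; case: (_ \in _); rewrite /= ?lexx ?ler01.
have mB1 : measurable_fun setT (\1_B : T1 -> R) by exact: measurable_indic.
have mBf : measurable_fun setT (fun y : T1 * E => \1_B y.1 : R).
  exact: (measurableT_comp mB1).
have mBU : measurable_fun setT (fun w => \1_B (U w) : R).
  exact: (measurableT_comp mB1).
have ma l : measurable_fun setT (a l).
  apply: measurable_funM; [exact: mBf|exact: mG].
have aq l u f : `|a l (u, f)| <= q f.
  rewrite /a normrM (le_trans _ (Gq u f)) //.
  have /andP[i0 i1] := ind01 u.
  rewrite (ger0_norm i0) (le_trans (ler_piMl _ i1)) //.
  rewrite (le_trans (ip_cauchy_schwarz ip Hip _ _)) // ler_piMr //.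
  exact: gs_dir_norm_le1.
have a0 l i u : (\int[distribution P (V i)]_f (a l (u, f))%:E = 0)%E.
  have iG : (distribution P (V i)).-integrable setT
      (fun f => (ip (G u f) (e l))%:E).
    have mGu : measurable_fun setT (fun f => ip (G u f) (e l)).
      exact: (measurable_fun_pair2 u (mG (e l))).
    apply: integrable_pushforward => //; first exact/measurable_EFinP.
    apply: (@integrable_of_sqr _ _ _ P _ (q \o V i)) => [|w|]; last exact: qV.
      exact: (measurableT_comp mGu).
    rewrite (le_trans (ip_cauchy_schwarz ip Hip _ _)) //.
    by rewrite (le_trans (ler_piMr _ (gs_dir_norm_le1 ip D l))).
  under eq_integral do rewrite /a /= EFinM.
  by rewrite integralZl // G0 mule0.
pose cross N w := \sum_(l < N) \sum_(i < n) \sum_(j < n | j != i)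
  a l (U w, V i w) * a l (U w, V j w).
have cross0 N : P.-integrable setT (fun w => (cross N w)%:E) /\
    (\int[P]_w (cross N w)%:E = 0)%E.
  apply: integral0_sum => l _; apply: integral0_sum => i _.
  apply: integral0_sum => j ji; split.
    exact: (mean_zero_pair_integrable P U (V i) (V j) (a l) q).
  apply: (mean_zero_pair P U (V i) (V j) (a l) q) => //.
  - by apply: VV; rewrite eq_sym.
  - by apply: UVV; rewrite eq_sym.
pose diag w := \sum_(i < n) \1_B (U w) * q (V i w) ^+ 2.
have idiagi i : P.-integrable setT (fun w => (\1_B (U w) * q (V i w) ^+ 2)%:E).
  apply: le_integrable (qV i) => //.
    apply/measurable_EFinP; apply: measurable_funM => //.
    exact/measurable_funX/(measurableT_comp mq).
  move=> w _; rewrite lee_fin normrM.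
  have /andP[i0 i1] := ind01 (U w).
  by rewrite (ger0_norm i0) ler_piMl.
have idiag : P.-integrable setT (fun w => (diag w)%:E).
  under eq_fun do rewrite -sumEFin.
  exact: integrable_sum.
have diagE : (\int[P]_w (diag w)%:E = (n%:R * M)%:E * P (U @^-1` B))%E.
  under eq_integral do rewrite -sumEFin.
  rewrite integral_sum // (eq_bigr (fun=> M%:E * P (U @^-1` B)))%E => [|i _].
    rewrite -(fineK (fin_num_measure P _ (measurable_funPTI U mB))) -EFinM.
    by rewrite sumEFin sumr_const card_ord -EFinM -mulrA mulr_natl.
  rewrite (@independent_integral _ _ _ _ _ _ _ P U (V i) (UV i)
    (fun y => \1_B y.1 * q y.2 ^+ 2)) /=; last 2 first.
  - apply: measurable_funM => //.
    exact/measurable_funX/(measurableT_comp mq).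
  - exact: idiagi.
  have iq : (distribution P (V i)).-integrable setT (fun f => (q f ^+ 2)%:E).
    apply: integrable_pushforward => //; last exact: qV.
    exact/measurable_EFinP/measurable_funX.
  under eq_integral => u _.
    under eq_integral do rewrite EFinM.
    rewrite integralZl // qM muleC.
    over.
  rewrite integralZl //; last first.
    by apply: (@integrable_indic _ _ _ (distribution P U)) => //.
  by rewrite integral_indic // setIT.
pose S N w := \sum_(l < N) (\sum_(i < n) a l (U w, V i w)) ^+ 2.
have aE l i w :
  a l (U w, V i w) = \1_B (U w) * ip (G (U w) (V i w)) (e l) by [].
have ind2 u : \1_B u ^+ 2 = \1_B u :> R.
  by rewrite indicE; case: (_ \in _); rewrite ?expr1n ?expr0n.
have SE N w : S N w <= cross N w + diag w.
  have -> : S N w = cross N w +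
      \sum_(i < n) \sum_(l < N) a l (U w, V i w) ^+ 2.
    rewrite exchange_big /= /cross -big_split /=; apply: eq_bigr => l _.
    rewrite expr2 big_distrlr /= -big_split /=; apply: eq_bigr => i _.
    by rewrite (bigD1 i) //= addrC expr2.
  rewrite lerD2l; apply: ler_sum => i _.
  under eq_bigr do rewrite aE exprMn ind2.
  have /andP[i0 i1] := ind01 (U w).
  rewrite -mulr_sumr ler_wpM2l // (le_trans (bessel ip Hip D _ _)) //.
  by rewrite ler_pXn2r // nnegrE // (le_trans _ (Gq (U w) (V i w))).
have mS N : measurable_fun setT (S N).
  apply: measurable_sum => l; apply: measurable_funX.
  apply: measurable_sum => i; apply: measurableT_comp => //.
  exact: measurable_fun_pair.
apply: (@le_integral_nondecreasing _ _ _ P S) => //.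
- by move=> N w; apply: sumr_ge0 => l _; exact: sqr_ge0.
- move=> w; apply/nondecreasing_seqP => N.
  by rewrite /S big_ord_recr lerDl sqr_ge0.
- move=> w; rewrite /S.
  have -> : (fun N => \sum_(l < N) (\sum_(i < n) a l (U w, V i w)) ^+ 2) =
      (fun N => \1_B (U w) * \sum_(l < N)
        ip (\sum_i G (U w) (V i w)) (e l) ^+ 2).
    apply/funext => N; rewrite mulr_sumr; apply: eq_bigr => l _.
    under eq_bigr do rewrite aE.
    rewrite -mulr_sumr exprMn ind2; congr (_ * _ ^+ 2).
    by elim/big_rec2: _ => [|i y1 y2 _ ->]; rewrite ?(ip0l ip) ?(ipDl ip).
  apply: cvgMr; apply: parseval => //.
  have pE N : gram_schmidt ip D N (\sum_i G (U w) (V i w)) =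
      \sum_i gram_schmidt ip D N (G (U w) (V i w)).
    elim/big_rec2: _ => [|i y1 y2 _ <-]; last exact: gram_schmidtD.
    by rewrite -[X in gram_schmidt _ _ _ X](scale0r 0) gram_schmidtZ scale0r.
  under eq_fun do rewrite pE.
  apply: cvg_big => [|i _]; [exact: add_continuous|exact: gram_schmidt_cvg].
- move=> N.
  have [icross cross_eq0] := cross0 N.
  apply: (@le_trans _ _ (\int[P]_w ((cross N w)%:E + (diag w)%:E))%E).
    apply: ge0_le_integral => //.
    + by move=> w _; rewrite lee_fin; apply: sumr_ge0 => l _; exact: sqr_ge0.
    + exact/measurable_EFinP.
    + by have /measurable_int := integrableD measurableT icross idiag.
    + by move=> w _; rewrite lee_fin.
  by rewrite integralD // cross_eq0 add0e diagE.
Qed.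
End variance_bound.

(** * Bochner means and partial gradients *)

Section bochner_mean.
Context {R : realType} {H : completeNormedModType R} (ip : {dot H for idfun}).
Hypothesis Hip : norm_of_ip ip.
Context {d} {T : measurableType d} (P : probability T R).

Lemma simple_vector_strongly_measurable (s : T -> H) :
  simple_vector s -> strongly_measurable s.
Proof.
move=> [/finite_set_countable/countable_sub_range[g sg] ms].
apply: strongly_measurable_cover => eps eps0.
exists g, (fun m => s @^-1` [set g m]); split=> [m|w|m w /= ->].
- exact: ms.
- by have [m _ gm] := sg (s w) (ex_intro2 _ _ w I erefl); exists m.
- by rewrite subrr normr0.
Qed.

(** A simple vector is a finite combination of indicators, so its mean commutes
    with inner products. *)
Lemma integral_ip_simple (s : T -> H) h : simple_vector s ->
  P.-integrable setT (fun w => (ip (s w) h)%:E) /\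
  (\int[P]_w (ip (s w) h)%:E = (ip (simple_mean P s) h)%:E)%E.
Proof.
move=> [fs ms].
pose r := finmap.enum_fset (fset_set (range s)).
have sE w : ip (s w) h =
    \sum_(y <- r) ip y h * \1_(s @^-1` [set y]) w.
  have sw : s w \in r by rewrite /r in_fset_set // inE; exists w.
  rewrite (bigD1_seq (s w)) ?finmap.fset_uniq //= indicE mem_set // mulr1.
  rewrite big1 ?addr0 // => y ys; rewrite indicE memNset ?mulr0 //=.
  by move=> /esym /eqP; apply/negP.
have mi y : P.-integrable setT (fun w => (\1_(s @^-1` [set y]) w)%:E).
  exact: integrable_indic.
have -> : (fun w => (ip (s w) h)%:E) = (fun w =>
    \sum_(y <- r) (ip y h)%:E * (\1_(s @^-1` [set y]) w)%:E)%E.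
  by apply/funext => w; rewrite sE sumEFin.
split; first by apply: integrable_sum => // y _; exact: integrableZl.
rewrite integral_sum //; last by move=> y; exact: integrableZl.
rewrite /simple_mean fsbig_finite //=.
have -> : ip (\sum_(y <- r) fine (P (s @^-1` [set y])) *: y) h
    = \sum_(y <- r) fine (P (s @^-1` [set y])) * ip y h.
  elim/big_rec2: _ => [|y a b _ <-]; first exact: ip0l.
  by rewrite (ipDl ip) (ipZl ip).
rewrite -sumEFin; apply: eq_bigr => y _.
rewrite integralZl // integral_indic // setIT muleC EFinM fineK //.
exact: fin_num_measure.
Qed.

(** Bochner means are limits of means of simple vectors; the error made on
    inner products with [h] is at most the norm of [h] times the mean distance
    to [X]. *)
Lemma bochner_mean_ip (X : T -> H) v h : is_bochner_mean P X v ->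
  P.-integrable setT (fun w => (`|X w|)%:E) ->
  P.-integrable setT (fun w => (ip (X w) h)%:E) /\
  (\int[P]_w (ip (X w) h)%:E = (ip v h)%:E)%E.
Proof.
move=> [rX [s [ss sX sv]]] iX.
have mX := random_vector_strongly_measurable _ rX.
have iXh : P.-integrable setT (fun w => (ip (X w) h)%:E).
  apply: le_integrable (integrableZl measurableT `|h| iX) => //.
    apply/measurable_EFinP.
    exact: (continuous_strongly_measurable _ _ mX (ip_continuousl ip Hip h)).
  move=> w _; rewrite lee_fin normrM !normr_id mulrC.
  exact: ip_cauchy_schwarz.
split=> //.
have mXs m : strongly_measurable (fun w => X w - s m w).
  apply: strongly_measurableD => //.
  under eq_fun do rewrite -scaleN1r.
  exact/strongly_measurableZ/simple_vector_strongly_measurable.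
have mN m : measurable_fun setT (fun w => `|X w - s m w|).
  exact: (continuous_strongly_measurable _ _ (mXs m) (@norm_continuous _ H)).
have iXhE := fineK (integrable_fin_num measurableT iXh).
rewrite -iXhE; congr (_%:E).
apply/eqP; rewrite -subr_eq0 -normr_eq0 eq_le normr_ge0 andbT.
set I := fine _ in iXhE *.
have /fine_cvgP[finE cvgE] := sX.
have cl : (fun m => `|I - ip (simple_mean P (s m)) h|) @ \oo --> `|I - ip v h|.
  apply: (@cvg_norm _ R^o); apply: cvgB; first exact: cvg_cst.
  exact: (continuous_cvg _ (ip_continuousl ip Hip h v) sv).
have cr : (fun m => `|h| * fine ('E_P[fun w => `|X w - s m w|%R])%E) @ \oo
    --> (0 : R).
  by rewrite -[X in _ --> X](mulr0 `|h|); apply: cvgMr.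
apply: (ler_cvg_to cl cr); near=> m.
have finm : ('E_P[fun w => `|X w - s m w|%R])%E \is a fin_num.
  by near: m; exact: finE.
have [ish shE] := integral_ip_simple _ h (ss m).
rewrite -lee_fin EFinM fineK // -abse_EFin EFinB iXhE -shE -integralB //.
have /measurable_int mB := integrableB measurableT iXh ish.
rewrite (le_trans (le_abse_integral _ measurableT mB)) //.
rewrite unlock -ge0_integralZl //; last exact/measurable_EFinP.
apply: ge0_le_integral => //.
- exact: (measurableT_comp _ mB).
- by apply/measurable_EFinP; exact: measurable_funM.
- move=> w _; rewrite -EFinB abse_EFin lee_fin -(ipBl ip) mulrC.
  exact: ip_cauchy_schwarz.
Unshelve. all: by end_near. Qed.

(** Test the mean against [v] itself. *)
Lemma bochner_mean_norm_le (X : T -> H) v : is_bochner_mean P X v ->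
  P.-integrable setT (fun w => (`|X w|)%:E) ->
  (`|v|%:E <= \int[P]_w (`|X w|)%:E)%E.
Proof.
move=> bX iX; have [iXv XvE] := bochner_mean_ip X v v bX iX.
have [->|v0] := eqVneq v 0.
  by rewrite normr0; apply: integral_ge0 => w _; rewrite lee_fin.
have nv : 0 < `|v| by rewrite normr_gt0.
rewrite -(@lee_pmul2r _ `|v|%:E) // -?EFinM -?integralZr //.
rewrite -expr2 -Hip -XvE; apply: le_integral => //.
  by apply: integrableZr.
move=> w _; rewrite -EFinM lee_fin (le_trans (ler_norm _)) //.
exact: ip_cauchy_schwarz.
Qed.

End bochner_mean.

Section partial_gradient.
Context {R : realType} {H : completeNormedModType R} (ip : {dot H for idfun}).
Context {d d'} {T1 : measurableType d} {E : measurableType d'}.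
Context (L : H -> E -> R) (gL : H -> E -> H).
Hypothesis Lmeas : forall x, measurable_fun setT (L x).
Hypothesis HgL : forall x e, is_gradient ip (L^~ e) x (gL x e).

(** The loss is a Caratheodory function of the point and the sample, so its
    difference quotients are jointly measurable; the inner product is their
    limit. *)
Lemma partial_gradient_measurable (X : T1 -> H) h : strongly_measurable X ->
  measurable_fun setT (fun y : T1 * E => ip (gL (X y.1) y.2) h).
Proof.
move=> sX.
have cL e : continuous (fun c => L c e : R^o).
  by move=> c; apply: differentiable_continuous; have [] := HgL c e.
apply: (@measurable_fun_cvg _ _ _ _ (fun m (y : T1 * E) =>
  m.+1%:R * (L (X y.1 + m.+1%:R^-1 *: h) y.2 - L (X y.1) y.2))) => [m|y _].
  pose Phi c e := m.+1%:R * (L (c + m.+1%:R^-1 *: h) e - L c e).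
  apply: (@caratheodory_measurable _ _ _ _ _ _ _ Phi) => // [c|e].
    by apply: measurable_funM => //; exact: measurable_funB.
  move=> c; apply: cvgMr; apply: cvgB; last exact: cL.
  have ch : (fun c' => c' + m.+1%:R^-1 *: h) @ c --> c + m.+1%:R^-1 *: h.
    by apply: cvgD; [exact: cvg_id|exact: cvg_cst].
  exact: (continuous_cvg _ (cL e _) ch).
exact: gradient_quotient_cvg (HgL _ _).
Qed.

End partial_gradient.

(** * Conditional expectations *)

Section factored_expectation.
Context {R : realType} {d d'} {T : measurableType d} {T' : measurableType d'}
  (P : probability T R) (pi : {mfun T >-> T'}) (X : T -> R)
  (intX : P.-integrable setT (EFin \o X)).

(** The charge whose density with respect to the law of [pi] is the expectation
    of [X] given [pi]. *)
Definition pushed_charge (A : set T') : \bar R :=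
  induced_charge intX (pi @^-1` A).

Let pushed_charge0 : pushed_charge set0 = 0%E.
Proof. by rewrite /pushed_charge preimage_set0 charge0. Qed.

Let pushed_charge_finite A : measurable A -> pushed_charge A \is a fin_num.
Proof. by move=> mA; apply: fin_num_measure; exact: measurable_funPTI. Qed.

Let pushed_charge_sigma_additive : semi_sigma_additive pushed_charge.
Proof.
move=> F mF tF mUF; rewrite /pushed_charge preimage_bigcup.
apply: charge_semi_sigma_additive.
- by move=> n; exact: measurable_funPTI.
- apply/trivIsetP => /= i j _ _ ij; rewrite -preimage_setI.
  by move/trivIsetP : tF => /(_ _ _ _ _ ij) ->//; rewrite preimage_set0.
- by rewrite -preimage_bigcup; exact: measurable_funPTI.
Qed.

HB.instance Definition _ := isCharge.Build _ _ _ pushed_charge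
  pushed_charge0 pushed_charge_finite pushed_charge_sigma_additive.

Lemma factored_expectation : exists Y : T' -> R,
  [/\ measurable_fun setT Y, P.-integrable setT (fun w => (Y (pi w))%:E) &
      forall A, measurable A -> (\int[P]_(w in pi @^-1` A) (Y (pi w))%:E =
                                 \int[P]_(w in pi @^-1` A) (X w)%:E)%E].
Proof.
have dom : pushed_charge `<< distribution P pi.
  apply/null_content_dominatesP => A mA PA0; apply: null_set_integral => //.
    exact: measurable_funPTI.
  exact: measurable_funTS (measurable_int _ intX).
pose Z := Radon_Nikodym pushed_charge (distribution P pi).
have Zfin y : Z y \is a fin_num by exact: Radon_Nikodym_fin_num.
have iZ := Radon_Nikodym_integrable dom.
have mZ : measurable_fun setT Z := measurable_int _ iZ.
have ZE : EFin \o (fine \o Z) = Z by apply/funext => y; rewrite /= fineK.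
have iY : P.-integrable setT (fun w => (fine (Z (pi w)))%:E).
  apply/integrableP; split.
    apply/measurable_EFinP; apply: measurableT_comp => //.
    exact: measurableT_comp.
  move/integrableP : iZ => [_]; rewrite ge0_integral_distribution //.
    by move=> fin; under eq_integral do rewrite fineK //.
  exact: measurableT_comp.
exists (fine \o Z); split=> //; first exact: measurableT_comp.
move=> A mA; transitivity (pushed_charge A) => //.
rewrite (Radon_Nikodym_integral dom mA) -[Radon_Nikodym _ _]ZE.
rewrite integral_pushforward //; first by rewrite ZE.
apply: integrableS iY => //; exact: measurable_funPTI.
Qed.

End factored_expectation.

Section conditional_expectation.
Context {R : realType} {d} {T : measurableType d} (P : probability T R).

(** A sub-sigma-algebra is treated as the measurable structure of another copy
    of [T]: being measurable for it is then measurability on that copy, and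
    conditioning on it is conditioning on this map. *)
Definition id_to_sub (F : set (set T)) : T -> g_sigma_algebraType F := id.

Lemma sub_sigma_measurable (F : set (set T)) :
  F `<=` measurable -> <<s F >> `<=` measurable.
Proof.
by move=> FM; apply: smallest_sub => //; exact: sigma_algebra_measurable.
Qed.

Lemma id_to_sub_measurable (F : set (set T)) :
  F `<=` measurable -> measurable_fun setT (id_to_sub F).
Proof. by move=> FM _ B mB; rewrite setTI; exact: sub_sigma_measurable mB. Qed.

Definition sub_mfun (F : set (set T)) (FM : F `<=` measurable) :
    {mfun T >-> g_sigma_algebraType F} :=
  HB.pack (id_to_sub F)
    (isMeasurableFun.Build _ _ _ _ _ (id_to_sub_measurable F FM)).

Lemma cond_expectation_exists (F : set (set T)) (X : T -> R) :
  F `<=` measurable -> P.-integrable setT (EFin \o X) ->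
  exists Y, is_cond_expectation P <<s F >> X Y.
Proof.
move=> FM intX.
have [Y [mY iY YE]] := factored_expectation P (sub_mfun F FM) X intX.
exists Y; split=> // B mB.
by have := mY measurableT B mB; rewrite setTI.
Qed.

Lemma negligible_of_integral_le0 (B : set T) (f : T -> R) : measurable B ->
  P.-integrable B (EFin \o f) -> (forall w, B w -> 0 < f w) ->
  (\int[P]_(w in B) (f w)%:E <= 0)%E -> P.-negligible B.
Proof.
move=> mB iB f0 int0.
have : (\int[P]_(w in B) `|(f w)%:E| = 0)%E.
  apply/eqP; rewrite eq_le integral_ge0 ?andbT //.
  rewrite (le_trans _ int0) // le_eqVlt; apply/orP; left; apply/eqP.
  apply: eq_integral => w; rewrite inE => /f0 fw.
  by rewrite abse_EFin gtr0_norm.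
move=> /(ae_eq_integral_abs P mB (measurable_int _ iB))[N [mN N0 sN]].
exists N; split=> // w Bw; apply: sN => /= /(_ Bw) [fw0].
by have := f0 _ Bw; rewrite fw0 ltxx.
Qed.

(** The events [Y > t] and [Y < 0] belong to the sub-sigma-algebra, so on them
    the integrals of [Y] and [X] agree; strict inequality on a non-negligible
    event would contradict the bounds on [X]. *)
Lemma cond_expectation_bounded (F : set (set T)) (X Y : T -> R) (t : R) :
  F `<=` measurable -> is_cond_expectation P <<s F >> X Y ->
  (forall w, 0 <= X w) ->
  (forall B, <<s F >> B -> (\int[P]_(w in B) (X w)%:E <= t%:E * P B)%E) ->
  {ae P, forall w, `|Y w| <= t}.
Proof.
move=> FM [iX iY mY YE] X0 XB.
have GM := sub_sigma_measurable F FM.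
have Glt : <<s F >> (Y @^-1` `]t, +oo[) by exact: mY.
have Gneg : <<s F >> (Y @^-1` `]-oo, 0[) by exact: mY.
have Nt : P.-negligible (Y @^-1` `]t, +oo[).
  have mB := GM _ Glt; set B := _ @^-1` _ in Glt mB *.
  have iYB : P.-integrable B (EFin \o Y) by exact: integrableS iY.
  have it : P.-integrable B (cst t%:E).
    apply: (integrableS measurableT) => //.
    exact: finite_measure_integrable_cst.
  apply: (negligible_of_integral_le0 B (fun w => Y w - t)) => //.
  - exact: (integrableB mB iYB it).
  - by move=> w; rewrite /B /= in_itv /= andbT subr_gt0.
  - under eq_integral do rewrite EFinB.
    rewrite integralB // integral_cst // YE // sube_le0 XB //.
have N0 : P.-negligible (Y @^-1` `]-oo, 0[).
  have mB := GM _ Gneg; set B := _ @^-1` _ in Gneg mB *.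
  have iYB : P.-integrable B (EFin \o Y) by exact: integrableS iY.
  apply: (negligible_of_integral_le0 B (fun w => - Y w)) => //.
  - exact: (integrableN iYB).
  - by move=> w; rewrite /B /= in_itv /= oppr_gt0.
  - under eq_integral do rewrite EFinN.
    rewrite integralN ?integrable_add_def // YE // oppe_le0.
    by apply: integral_ge0 => w _; rewrite lee_fin.
have [N [mN PN sN]] := negligibleU Nt N0.
exists N; split=> // w /= nw; apply: sN; rewrite /= !in_itv /= andbT.
apply/orP; apply: contra_notT nw; rewrite negb_or -!leNgt => /andP[Yt Y0].
by rewrite ger0_norm.
Qed.

End conditional_expectation.

(** * The error of a batch drawn independently of the past *)

Section batch_mean.
Context {R : realType} {H : completeNormedModType R}.
Context {d} {T : measurableType d} (P : probability T R).

(** Integrate [|v| <= t / 2 + |v|^2 / (2 t)] with [v = S / n] over [B]; the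
    condition on [M] makes the second term at most [t / 2 * P B]. *)
Lemma integral_norm_le_of_sqr (S : T -> H) (n : nat) (M t : R) (B : set T) :
  measurable B -> (0 < n)%N -> 0 < t -> M <= n%:R * t ^+ 2 ->
  measurable_fun setT (fun w => `|S w|) ->
  (\int[P]_w (\1_B w * `|S w| ^+ 2)%:E <= (n%:R * M)%:E * P B)%E ->
  (\int[P]_(w in B) (`|n%:R^-1 *: S w|)%:E <= t%:E * P B)%E.
Proof.
move=> mB n0 t0 Mt mS SB.
have nR : 0 < n%:R :> R by rewrite ltr0n.
have tn0 : 0 < 2 * t * n%:R ^+ 2 by rewrite !mulr_gt0 ?exprn_gt0.
pose c := (2 * t * n%:R ^+ 2)^-1.
have c0 : 0 < c by rewrite invr_gt0.
have mBf : measurable_fun setT (\1_B : T -> R) by exact: measurable_indic.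
have mS2 : measurable_fun setT (fun w => \1_B w * `|S w| ^+ 2).
  by apply: measurable_funM => //; exact: measurable_funX.
(* t / 2 + y^2 / (2 t) - y, taken at y / n, is a square over 2 t. *)
have amgm y : 0 <= y -> n%:R^-1 * y <= t / 2 + c * y ^+ 2.
  move=> y0; rewrite -subr_ge0.
  have -> : t / 2 + c * y ^+ 2 - n%:R^-1 * y =
      (t - n%:R^-1 * y) ^+ 2 / (2 * t).
    by rewrite /c; field; rewrite !gt_eqF.
  by rewrite divr_ge0 ?sqr_ge0 // mulr_ge0 // ltW.
have cM : c * (n%:R * M) <= t / 2.
  have -> : t / 2 = c * (n%:R * (n%:R * t ^+ 2)).
    by rewrite /c; field; rewrite !gt_eqF.
  by rewrite ler_wpM2l ?ler_wpM2l // ltW.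
have finB := fin_num_measure P _ mB.
have pB0 : 0 <= fine (P B) by rewrite fine_ge0.
apply: (@le_trans _ _ (\int[P]_w
  ((t / 2)%:E * (\1_B w)%:E + c%:E * (\1_B w * `|S w| ^+ 2)%:E))%E).
  rewrite integral_mkcond; apply: ge0_le_integral => //.
  - by move=> w _; rewrite patchE; case: ifP => // _; rewrite lee_fin.
  - apply/(measurable_restrictT _ mB)/measurable_EFinP/measurable_funTS.
    under eq_fun do rewrite normrZ.
    exact: measurable_funM.
  - by apply: emeasurable_funD; apply/measurable_EFinP; exact: measurable_funM.
  - move=> w _; rewrite patchE indicE; case: ifP => wB; last first.
      by rewrite !mul0r !mule0 adde0.
    rewrite mule1 mul1r -EFinM -EFinD lee_fin normrZ ger0_norm ?invr_ge0 //.
    exact: amgm.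
rewrite ge0_integralD //; last 4 first.
- by move=> w _; rewrite -EFinM lee_fin mulr_ge0 // divr_ge0 // ltW.
- by apply/measurable_EFinP; exact: measurable_funM.
- move=> w _; rewrite -EFinM lee_fin mulr_ge0 ?(ltW c0) // mulr_ge0 ?sqr_ge0 //.
- by apply/measurable_EFinP; exact: measurable_funM.
rewrite ge0_integralZl //; last 2 first.
- exact/measurable_EFinP.
- by rewrite lee_fin divr_ge0 // ltW.
rewrite ge0_integralZl //; last 2 first.
- exact/measurable_EFinP.
- by rewrite lee_fin ltW.
rewrite integral_indic // setIT.
have c0E : (0 <= c%:E)%E by rewrite lee_fin ltW.
rewrite (le_trans (leeD2l _ (lee_wpmul2l c0E SB))) //.
rewrite -(fineK finB) -[X in (_ * X + _)%E](fineK finB) -!EFinM -EFinD.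
rewrite lee_fin mulrA -mulrDl ler_wpM2r //.
by rewrite (le_trans (lerD (lexx _) cM)) // -splitr.
Qed.
End batch_mean.

Section independent_batch.
Context {R : realType} {d d'} {T : measurableType d} {E : measurableType d'}
  (P : probability T R) (F : set (set T)) (n : nat)
  (V : 'I_n -> {mfun T >-> E}).
Hypothesis FM : F `<=` measurable.
Hypothesis fresh : independent2 P <<s F >> (batch_sigma (fun i w => V i w)).

(** Each sample is measurable for the sigma-algebra of the whole batch, hence
    so are pairs of samples: independence of the batch and the past specializes
    to single samples and to pairs. *)
Lemma sample_batch_measurable i :
  measurable_fun setT (V i : g_sigma_algebraType
    (\bigcup_i preimage_set_system setT (V i) measurable) -> E).
Proof.
move=> _ B mB; apply: sub_sigma_algebra; exists i => //.
by exists B.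
Qed.

Lemma fresh_sample i : independent_maps P (sub_mfun F FM) (V i).
Proof.
move=> A B mA mB; apply: fresh => //.
by have := sample_batch_measurable i measurableT B mB; rewrite setTI.
Qed.

Lemma fresh_pair i j :
  independent_maps P (sub_mfun F FM) (pair_map (V i) (V j)).
Proof.
move=> A B mA mB; apply: fresh => //.
have := measurable_fun_pair (sample_batch_measurable i)
  (sample_batch_measurable j).
by move=> /(_ measurableT B mB); rewrite setTI.
Qed.

End independent_batch.

Lemma mutually_independent_pair {R : realType} {d d'} {T : measurableType d}
    {E : measurableType d'} (P : probability T R) (I : eqType)
    (V : I -> {mfun T >-> E}) :
  mutually_independent P
    (fun i => preimage_set_system setT (V i) measurable) ->
  forall i j, i != j -> independent_maps P (V i) (V j).
Proof.
move=> indep i j ij A B mA mB.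
pose D k := if k == i then V i @^-1` A else V j @^-1` B.
have Di : D i = V i @^-1` A by rewrite /D eqxx.
have Dj : D j = V j @^-1` B by rewrite /D eq_sym (negbTE ij).
have := indep [:: i; j] D.
rewrite /= mem_seq1 ij /= => /(_ isT).
rewrite !big_cons big_nil mule1 Di Dj => <-.
  congr (P _); apply/seteqP; split=> [w [Aw Bw] k /=|w Dw].
    by rewrite !inE => /orP[]/eqP ->; rewrite ?Di ?Dj.
  by split; [rewrite -Di; apply: Dw|rewrite -Dj; apply: Dw];
    rewrite /= !inE eqxx ?orbT.
move=> k; rewrite !inE => /orP[]/eqP ->; rewrite ?Di ?Dj.
  by exists A => //; rewrite setTI.
by exists B => //; rewrite setTI.
Qed.

Section same_law.
Context {R : realType} {d d'} {T : measurableType d} {E : measurableType d'}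
  (P : probability T R) (V W : {mfun T >-> E}).
Hypothesis VW : forall B, measurable B -> P (V @^-1` B) = P (W @^-1` B).

Lemma same_law_integral (f : E -> R) :
  (\int[distribution P V]_e (f e)%:E = \int[distribution P W]_e (f e)%:E)%E.
Proof. by apply: eq_measure_integral => A mA _; exact: VW. Qed.

Lemma same_law_integrable (f : E -> R) : measurable_fun setT f ->
  P.-integrable setT (fun w => (f (W w))%:E) ->
  P.-integrable setT (fun w => (f (V w))%:E).
Proof.
move=> mf /integrableP[_ fW]; apply/integrableP; split.
  by apply/measurable_EFinP; exact: measurableT_comp.
have mEf : measurable_fun setT (fun e => `|(f e)%:E|)%E.
  by apply: measurableT_comp => //; exact/measurable_EFinP.
rewrite -(ge0_integral_distribution V mEf) //.
rewrite (@eq_measure_integral _ _ _ _ (distribution P W)) => [|A mA _].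
  by rewrite ge0_integral_distribution.
exact: VW.
Qed.

End same_law.

Section fresh_batch.
Context {R : realType} {H : completeNormedModType R} (ip : {dot H for idfun}).
Hypothesis Hip : norm_of_ip ip.
Context {d d'} {T : measurableType d} {E : measurableType d'}
  (P : probability T R) (eta : {mfun T >-> E}).
Context (C : set H) (L : H -> E -> R) (gL : H -> E -> H) (gradf : H -> H).
Hypothesis Lmeas : forall x, measurable_fun setT (L x).
Hypothesis HgL : forall x e, is_gradient ip (L^~ e) x (gL x e).
Hypothesis HE1 : forall c, C c ->
  is_bochner_mean P (fun w => gL c (eta w)) (gradf c).
Hypothesis gLmeas : forall c, C c -> random_vector (gL c).
Context (q : E -> R) (M : R).
Hypothesis mq : measurable_fun setT q.
Hypothesis gLq : forall c e, C c -> `|gL c e| <= q e.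
Hypothesis errq : forall c e, C c -> `|gL c e - gradf c| <= q e.
Hypothesis iq : P.-integrable setT (fun w => (q (eta w) ^+ 2)%:E).
Hypothesis qM : (\int[P]_w (q (eta w) ^+ 2)%:E = M%:E)%E.
Context (F : set (set T)) (n : nat) (V : 'I_n -> {mfun T >-> E}).
Hypothesis FM : F `<=` measurable.
Hypothesis fresh : independent2 P <<s F >> (batch_sigma (fun i w => V i w)).
Hypothesis Vid : forall i B, measurable B -> P (V i @^-1` B) = P (eta @^-1` B).
Hypothesis VV : forall i j, i != j -> independent_maps P (V i) (V j).
Context (X : g_sigma_algebraType F -> H).
Hypothesis sX : strongly_measurable X.
Hypothesis XC : forall w, C (X w).
Hypothesis sgL : forall i, random_vector (fun w : T => gL (X w) (V i w)).
Hypothesis sgf : random_vector (fun w : T => gradf (X w)).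
Hypothesis n0 : (0 < n)%N.

Let pi : {mfun T >-> g_sigma_algebraType F} := sub_mfun F FM.
Let G (u : g_sigma_algebraType F) (e : E) : H := gL (X u) e - gradf (X u).

Let sG i : strongly_measurable (fun w : T => G (pi w) (V i w)).
Proof.
apply: strongly_measurableD; first exact/random_vector_strongly_measurable/sgL.
under eq_fun do rewrite -scaleN1r.
exact/strongly_measurableZ/random_vector_strongly_measurable.
Qed.

Let q0 e : 0 <= q e.
Proof. exact: le_trans (normr_ge0 _) (gLq _ e (XC point)). Qed.

Let iqV i : P.-integrable setT (fun w => (q (V i w) ^+ 2)%:E).
Proof.
apply: (same_law_integrable P (V i) eta (Vid i) (fun e => q e ^+ 2)) => //.
exact: measurable_funX.
Qed.

Let ip_mean c h : C c ->
  (\int[distribution P eta]_e (ip (gL c e) h)%:E = (ip (gradf c) h)%:E)%E /\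
  (distribution P eta).-integrable setT (fun e => (ip (gL c e) h)%:E).
Proof.
move=> Cc.
have sgc := random_vector_strongly_measurable _ (gLmeas _ Cc).
have mN : measurable_fun setT (fun e => `|gL c e|).
  exact: (continuous_strongly_measurable _ _ sgc (@norm_continuous _ H)).
have iN : P.-integrable setT (fun w => (`|gL c (eta w)|)%:E).
  apply: (@integrable_of_sqr _ _ _ P _ (q \o eta)) => [|w|]; last exact: iq.
    exact: (measurableT_comp mN).
  by rewrite normr_id; exact: gLq.
have [igL gLE] := bochner_mean_ip ip Hip P _ _ h (HE1 _ Cc) iN.
have mip : measurable_fun setT (fun e => (ip (gL c e) h)%:E).
  apply/measurable_EFinP.
  exact: (continuous_strongly_measurable _ _ sgc (ip_continuousl ip Hip h)).
by split; [rewrite integral_distribution|exact: integrable_pushforward].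
Qed.

Let mG h : measurable_fun setT
  (fun y : g_sigma_algebraType F * E => ip (G y.1 y.2) h).
Proof.
have mg := partial_gradient_measurable ip L gL Lmeas HgL X h sX.
under eq_fun do rewrite /G (ipBl ip).
apply: measurable_funB => //.
(* The mean gradient is measurable as the integral of the jointly measurable
   inner product over one sample; a batch is nonempty. *)
pose i0 : 'I_n := Ordinal n0.
have ig : P.-integrable setT (fun w => (ip (gL (X (pi w)) (V i0 w)) h)%:E).
  have iqi : P.-integrable setT (fun w => (q (V i0 w))%:E).
    apply: (@integrable_of_sqr _ _ _ P _ (q \o V i0)) => [|w|]; last exact: iqV.
      exact: measurableT_comp.
    by rewrite ger0_norm.
  apply: le_integrable (integrableZl measurableT `|h| iqi) => //.
    apply/measurable_EFinP.
    exact: (continuous_strongly_measurable _ _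
      (random_vector_strongly_measurable _ (sgL i0)) (ip_continuousl ip Hip h)).
  move=> w _; rewrite lee_fin [X in _ <= X]ger0_norm ?mulr_ge0 // mulrC.
  by rewrite (le_trans (ip_cauchy_schwarz ip Hip _ _)) // ler_wpM2r // gLq.
have mI := measurable_fubini_F (independent_integrable P pi (V i0)
  (fresh_sample P F n V FM fresh i0)
  (fun y => ip (gL (X y.1) y.2) h) mg ig).
have -> : (fun y : g_sigma_algebraType F * E => ip (gradf (X y.1)) h) =
    (fun y => fine (\int[distribution P (V i0)]_e (ip (gL (X y.1) e) h)%:E)).
  apply/funext => y.
  rewrite (same_law_integral P (V i0) eta (Vid i0)
    (fun e => ip (gL (X y.1) e) h)).
  by have [-> _] := ip_mean (X y.1) h (XC y.1).
exact: (measurableT_comp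
  (measurableT_comp (@fine_measurable R _ measurableT) mI) measurable_fst).
Qed.

Let meanG i u h : (\int[distribution P (V i)]_e (ip (G u e) h)%:E = 0)%E.
Proof.
have [gE ig] := ip_mean (X u) h (XC u).
rewrite (same_law_integral P (V i) eta (Vid i) (fun e => ip (G u e) h)).
under eq_integral do rewrite /G (ipBl ip) EFinB.
rewrite integralB //; last exact: finite_measure_integrable_cst.
rewrite gE integral_cst // [X in (_ * X)%E](_ : _ = 1%E) ?mule1 ?subee //.
exact: (@probability_setT _ _ _ (distribution P eta)).
Qed.

Lemma batch_error_sum w :
  n%:R^-1 *: (\sum_(i < n) gL (X w) (V i w)) - gradf (X w) =
  n%:R^-1 *: \sum_(i < n) G (pi w) (V i w).
Proof.
rewrite /G sumrB sumr_const card_ord scalerBr; congr (_ - _).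
rewrite -[gradf _ *+ _]scaler_nat scalerA mulVf ?scale1r //.
by rewrite pnatr_eq0 -lt0n.
Qed.

Let msum : measurable_fun setT (fun w => `|\sum_(i < n) G (pi w) (V i w)|).
Proof.
exact: (continuous_strongly_measurable _ _ (strongly_measurable_sum _ _ sG)
  (@norm_continuous _ H)).
Qed.

(** An instance of [variance_bound] in which the frozen variable is the outcome
    itself, seen through the past: the vectors [G] depend on the outcome only
    through [X]. *)
Lemma fresh_batch_error (t : R) (B : set T) : <<s F >> B -> 0 < t ->
  M <= n%:R * t ^+ 2 ->
  (\int[P]_(w in B) (`|n%:R^-1 *: (\sum_(i < n) gL (X w) (V i w))
     - gradf (X w)|)%:E <= t%:E * P B)%E.
Proof.
move=> FB t0 Mt; under eq_integral do rewrite batch_error_sum.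
have mB := sub_sigma_measurable F FM _ FB.
apply: (integral_norm_le_of_sqr P _ n M) => //.
apply: (variance_bound ip Hip P pi n V G q M) => // [u e|i|i|i j ij].
- exact: errq.
- rewrite (same_law_integral P (V i) eta (Vid i) (fun e => q e ^+ 2)) -qM.
  rewrite integral_distribution //.
  exact/measurable_EFinP/measurable_funX.
- exact: (fresh_sample P F n V FM fresh).
- exact: (fresh_pair P F n V FM fresh).
Qed.

Lemma fresh_batch_integrable :
  P.-integrable setT (fun w => (`|n%:R^-1 *: (\sum_(i < n) gL (X w) (V i w))
     - gradf (X w)|)%:E).
Proof.
apply/integrableP; split.
  apply/measurable_EFinP; under eq_fun do rewrite batch_error_sum normrZ.
  exact: measurable_funM.
under eq_integral do rewrite abse_EFin normr_id.
have nR : 1 <= n%:R :> R by rewrite ler1n.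
have FT : <<s F >> [set: T] by exact: (@measurableT _ (g_sigma_algebraType F)).
apply: (le_lt_trans (fresh_batch_error (1 + `|M|) _ FT _ _)).
- by rewrite ltr_pwDl.
- have := ler_norm M; have := normr_ge0 M; nra.
- by rewrite probability_setT mule1 ltry.
Qed.

End fresh_batch.

(** * Gradient bounds, iterates and step sizes *)

Section envelope.
Context {R : realType} {H : completeNormedModType R} (ip : {dot H for idfun}).
Hypothesis Hip : norm_of_ip ip.
Context {d d'} {T : measurableType d} {E : measurableType d'}
  (P : probability T R) (eta : {mfun T >-> E}).
Context (C : set H) (gL : H -> E -> H) (gradf : H -> H) (omega : R -> R)
  (r : R).
Hypothesis Cr : forall c, C c -> `|c| <= r.
Hypothesis HE1 : forall c, C c ->
  is_bochner_mean P (fun w => gL c (eta w)) (gradf c).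
Hypothesis gLmeas : forall c, C c -> random_vector (gL c).
Hypothesis gL_omega : forall e x y, `|gL x e - gL y e| <= omega `|x - y|.
Hypothesis omega_nd : forall s s', 0 <= s -> s <= s' -> omega s <= omega s'.

(** Smoothness bounds [gL c] by [gL c0] plus the modulus at a bound on the
    diameter of [C]; the norm of the mean [gradf c] is at most the mean of
    these bounds, a constant. *)
Lemma gradient_error_envelope (c0 : H) : C c0 ->
  ('E_P[fun w => (`|gL c0 (eta w)| ^+ 2)%R] < +oo)%E ->
  exists q : E -> R, [/\ measurable_fun setT q,
    forall c e, C c -> `|gL c e| <= q e,
    forall c e, C c -> `|gL c e - gradf c| <= q e &
    P.-integrable setT (fun w => (q (eta w) ^+ 2)%:E)].
Proof.
move=> Cc0 fin2.
have mN c : C c -> measurable_fun setT (fun e => `|gL c e|).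
  move=> Cc.
  apply: (continuous_strongly_measurable _ _ _ (@norm_continuous _ H)).
  exact/random_vector_strongly_measurable/gLmeas.
have mNe c : C c -> measurable_fun setT (fun w => `|gL c (eta w)|).
  by move=> Cc; exact: (measurableT_comp (mN c Cc)).
have i2 : P.-integrable setT (fun w => (`|gL c0 (eta w)| ^+ 2)%:E).
  apply/integrableP; split.
    by apply/measurable_EFinP/measurable_funX; exact: mNe.
  move: fin2; rewrite unlock; congr (_ < _)%E.
  by apply: eq_integral => w _; rewrite abse_EFin ger0_norm ?sqr_ge0.
pose K1 := omega (r + r).
have gL1 c e : C c -> `|gL c e| <= `|gL c0 e| + K1.
  move=> Cc; rewrite -lerBlDl (le_trans (lerB_dist _ _)) //.
  rewrite (le_trans (gL_omega _ _ _)) // omega_nd //.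
  by rewrite (le_trans (ler_normB _ _)) // lerD ?Cr.
have sqrD (a b : R) : (a + b) ^+ 2 <= 2 * a ^+ 2 + 2 * b ^+ 2.
  have := sqr_ge0 (a - b); rewrite !expr2; lra.
have iK K : P.-integrable setT (fun w => ((`|gL c0 (eta w)| + K) ^+ 2)%:E).
  have icst : P.-integrable setT (cst (2 * K ^+ 2)%:E).
    exact: finite_measure_integrable_cst.
  apply: le_integrable (integrableD measurableT
    (integrableZl measurableT 2 i2) icst) => //.
    apply/measurable_EFinP/measurable_funX/measurable_funD => //.
    exact: mNe.
  move=> w _ /=; rewrite lee_fin ger0_norm ?sqr_ge0 // ger0_norm ?sqrD //.
  by rewrite addr_ge0 // mulr_ge0 // sqr_ge0.
have i1 : P.-integrable setT (fun w => (`|gL c0 (eta w)| + K1)%:E).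
  have K10 : 0 <= K1.
    have := gL_omega point c0 c0; rewrite !subrr !normr0 => w0.
    have r0 : 0 <= r by exact: le_trans (normr_ge0 _) (Cr _ Cc0).
    by apply: (le_trans w0); apply: omega_nd => //; exact: addr_ge0.
  apply: (integrable_of_sqr P (fun w => `|gL c0 (eta w)| + K1) _ _ _ (iK K1)).
    by apply: measurable_funD => //; exact: mNe.
  by move=> w; rewrite ger0_norm // addr_ge0.
pose K2 := fine (\int[P]_w (`|gL c0 (eta w)| + K1)%:E).
have gradf_le c : C c -> `|gradf c| <= K2.
  move=> Cc.
  have ic : P.-integrable setT (fun w => (`|gL c (eta w)|)%:E).
    apply: (@integrable_of_sqr _ _ _ P _ _ (mNe c Cc) _ (iK K1)) => w.
    by rewrite normr_id; exact: gL1.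
  rewrite -lee_fin fineK ?integrable_fin_num //.
  rewrite (le_trans (bochner_mean_norm_le ip Hip P _ _ (HE1 c Cc) ic)) //.
  by apply: le_integral => // w _; rewrite lee_fin; exact: gL1.
have K20 : 0 <= K2 by exact: le_trans (gradf_le c0 Cc0).
exists (fun e => `|gL c0 e| + (K1 + K2)); split.
- by apply: measurable_funD => //; exact: mN.
- by move=> c e Cc; rewrite (le_trans (gL1 c e Cc)) // addrA lerDl.
- move=> c e Cc; rewrite (le_trans (ler_normB _ _)) // addrA lerD ?gL1 //.
  exact: gradf_le.
- exact: iK.
Qed.

End envelope.

Section history.
Context {R : realType} {H G : completeNormedModType R}
  {d} {T : measurableType d}.
Context (x : nat -> T -> H) (mu0 : T -> G) (s : nat -> T -> H)
  (gamma : nat -> R).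
Hypothesis x0meas : random_vector (x 0%N).
Hypothesis mu0meas : random_vector mu0.
Hypothesis smeas : forall k, random_vector (s k).
Hypothesis Hx : forall k w, x k.+1 w = x k w - gamma k *: (x k w - s k w).

Definition history_gen (k : nat) : set (set T) :=
  preimage_set_system setT (x 0%N) open `|`
  preimage_set_system setT mu0 open `|`
  \bigcup_(i in `I_k.+1) preimage_set_system setT (s i) open.

Lemma history_gen_measurable k : history_gen k `<=` measurable.
Proof.
have sub (K : completeNormedModType R) (X : T -> K) : random_vector X ->
    preimage_set_system setT X open `<=` measurable.
  by move=> [mX _] _ [B oB <-]; rewrite setTI; exact: mX.
rewrite /history_gen => B [[xB|muB]|[i _ sB]].
- exact: (sub _ _ x0meas).
- exact: (sub _ _ mu0meas).
- exact: (sub _ _ (smeas i)).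
Qed.

(** By induction, [x j] is a combination of [x 0, s 0, ..., s (j - 1)], and the
    past contains the events of these vectors. *)
Lemma iterate_strongly_measurable k j : (j <= k.+1)%N ->
  strongly_measurable (x j : g_sigma_algebraType (history_gen k) -> H).
Proof.
pose T' := g_sigma_algebraType (history_gen k).
have sub (X : T -> H) : random_vector X ->
    preimage_set_system setT X open `<=` history_gen k ->
    strongly_measurable (X : T' -> H).
  move=> [_ sepX] XS; apply: random_vector_strongly_measurable; split=> // B oB.
  by apply: sub_sigma_algebra; apply: XS; exists B => //; rewrite setTI.
have sx0 : strongly_measurable (x 0%N : T' -> H).
  by apply: sub => // B xB; left; left.
have ss i : (i <= k)%N -> strongly_measurable (s i : T' -> H).
  by move=> ik; apply: sub => // B sB; right; exists i.
elim: j => // j IH jk.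
have -> : (x j.+1 : T' -> H) =
    (fun w => x j w + - gamma j *: (x j w + -1 *: s j w)).
  by apply/funext => w; rewrite Hx scaleNr scaleN1r.
have sj := IH (ltnW jk).
apply: strongly_measurableD => //; apply: strongly_measurableZ.
by apply: strongly_measurableD => //; apply: strongly_measurableZ; exact: ss.
Qed.

(** A step is a convex combination, as the step size is at most [1]. *)
Lemma iterate_in (C : set H) : convex_set C -> (forall k, 0 < gamma k <= 1) ->
  (forall w, C (x 0%N w)) -> (forall k w, C (s k w)) -> forall k w, C (x k w).
Proof.
move=> Cconv gamma01 x0C sC k w; elim: k => // k IH.
have /andP[g0 g1] := gamma01 k.
pose l : {i01 R} := Itv01 (ltW g0) g1.
have := Cconv (s k w) (x k w) l; rewrite !inE => /(_ (sC k w) IH).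
congr (C _); rewrite Hx /conv /=.
by rewrite /unstable.onem scalerBl scale1r scalerBr opprB addrCA.
Qed.

End history.

(** Were [z = 0], the extended quotient would be infinite and could not be
    bounded by a number of samples: the lower bound on [n] makes [z] and [n]
    positive. *)
Lemma batch_size_step {R : realType} (alpha g z : R) (n : nat) :
  0 < alpha -> 0 < g -> 0 <= z ->
  (alpha%:E * (g%:E / z%:E) ^+ 2 <= n%:R%:E)%E ->
  [/\ 0 < z, (0 < n)%N & alpha * g ^+ 2 <= n%:R * z ^+ 2].
Proof.
move=> a0 g0; rewrite le_eqVlt => /orP[/eqP<-|z0].
  rewrite inve0 gt0_muley ?lte_fin // expe2 mulyy gt0_muley ?lte_fin //.
rewrite inver gt_eqF // => h.
have nz : alpha * (g / z) ^+ 2 <= n%:R.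
  by rewrite -lee_fin EFinM EFin_expe EFinM.
have pos : 0 < alpha * (g / z) ^+ 2.
  by rewrite mulr_gt0 // exprn_gt0 // divr_gt0.
split=> //; first by rewrite -(ltr0n R) (lt_le_trans pos).
by rewrite -ler_pdivrMr ?exprn_gt0 // -mulrA -expr_div_n.
Qed.

Lemma cvgn_series_shift {R : realType} (u : nat -> R) (K : R) :
  cvgn (series u) -> cvgn (series (fun k => K * u k.+1)).
Proof.
move=> cu.
have -> : series (fun k => K * u k.+1) =
    (fun n => K * ([sequence series u n.+1]_n n - u 0%N)).
  apply/funext => n; rewrite !seriesEnat /= -mulr_sumr.
  by rewrite big_nat_recl // addrC addKr.
apply: is_cvgMr; apply: is_cvgB; last exact: is_cvg_cst.
by apply/cvg_ex; exists (limn (series u)); rewrite cvg_shiftS.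
Qed.

(** * Summability of the gradient errors *)

Theorem proposition5p3 (R : realType)
  (* the Hilbert spaces, C, A (with adjoint Aadj) and b *)
  (H : completeNormedModType R) (ip : {dot H for idfun})
  (Hip : norm_of_ip ip)
  (G : completeNormedModType R) (ipG : {dot G for idfun})
  (HipG : norm_of_ip ipG)
  (C : set H) (Cconv : convex_set C) (Ccomp : weakly_compact ip C)
  (A : {linear H -> G}) (Acont : continuous A)
  (Aadj : G -> H) (HAadj : forall x y, ipG (A x) y = ip x (Aadj y))
  (b : G) (Hb : range A b)
  (* the random variable eta, the loss L with its partial gradient gL, and the
     objective f x = E[L x eta] with its gradient gradf *)
  (d : measure_display) (T : measurableType d) (P : probability T R)
  (d' : measure_display) (E : measurableType d') (eta : {RV P >-> E})
  (L : H -> E -> R) (gL : H -> E -> H)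
  (Lmeas : forall x, measurable_fun setT (L x))
  (Lint : forall x, P.-integrable setT (fun w => (L x (eta w))%:E))
  (HgL : forall x e, is_gradient ip (L^~ e) x (gL x e))
  (gLmeas : forall x, C x -> random_vector (gL x))
  (f : H -> R) (Hf : forall x, f x = fine 'E_P[fun w => L x (eta w)]%E)
  (gradf : H -> H)
  (* the step sizes *)
  (zeta : R -> R) (zeta_ge0 : forall gam, 0 < gam <= 1 -> 0 <= zeta gam)
  (Hsmooth : Fzeta_smooth ip C f gradf zeta)
  (gamma rho theta : nat -> R)
  (Hgamma : forall k, 0 < gamma k <= 1)
  (Hrho : forall k, 0 <= rho k) (Htheta : forall k, 0 <= theta k)
  (Hzeta : cvgn (series (fun k => zeta (gamma k))))
  (* the samples: xi k i is the i-th of the n k samples drawn at iteration k *)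
  (n : nat -> nat) (xi : forall k, 'I_(n k) -> {RV P >-> E})
  (xi_id : forall k (i : 'I_(n k)) (B : set E), measurable B ->
     P (xi k i @^-1` B) = P (eta @^-1` B))
  (xi_indep : mutually_independent P
     (fun j : {k : nat & 'I_(n k)} =>
        preimage_set_system setT (xi (tag j) (tagged j)) measurable))
  (* the iteration *)
  (x : nat -> T -> H) (mu : nat -> T -> G) (s : nat -> T -> H)
  (lams : nat -> T -> R)
  (x0meas : random_vector (x 0%N)) (mu0meas : random_vector (mu 0%N))
  (smeas : forall k, random_vector (s k))
  (x0C : forall w, C (x 0%N w)) (mu0A : forall w, range A (mu 0%N w))
  (hatgrad : nat -> T -> H)
  (Hhatgrad : forall k w,
     hatgrad k w = (n k)%:R^-1 *: \sum_(i < n k) gL (x k w) (xi k i w))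
  (z : nat -> T -> H)
  (Hz : forall k w, z k w = hatgrad k w + Aadj (mu k w)
                            + rho k *: Aadj (A (x k w) - b))
  (lams_ge0 : forall k w, 0 <= lams k w)
  (sC : forall k w, C (s k w))
  (smin : forall k w c, C c -> ip (z k w) (s k w) <= ip (z k w) c + lams k w)
  (Hx : forall k w, x k.+1 w = x k w - gamma k *: (x k w - s k w))
  (Hmu : forall k w, mu k.+1 w = mu k w + theta k *: (A (x k.+1 w) - b))
  (* the samples of an iteration are drawn independently of the past *)
  (xi_fresh : forall k, independent2 P (history (x 0%N) (mu 0%N) s k)
                (batch_sigma (fun i w => xi k.+1 i w)))
  (* the gradient error is a random vector *)
  (hatmeas : forall k (i : 'I_(n k)),
     random_vector (fun w => gL (x k w) (xi k i w)))
  (gradfmeas : forall k, random_vector (fun w => gradf (x k w)))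
  (lam : nat -> T -> H)
  (Hlam : forall k w, lam k w = hatgrad k w - gradf (x k w))
  (* E[gradient of L] = gradient of f, and omega-smoothness of every L(., e) *)
  (HE1 : forall x, C x -> is_bochner_mean P (fun w => gL x (eta w)) (gradf x))
  (omega : R -> R) (Homega : smoothness_modulus omega)
  (HE2 : forall e, omega_smooth ip omega (L^~ e) (gL^~ e))
  (omega_nd : forall r r', 0 <= r -> r <= r' -> omega r <= omega r')
  (* second moment of the stochastic gradient at one point of C *)
  (HL2 : exists2 c, C c & ('E_P[fun w => (`|gL c (eta w)| ^+ 2)%R] < +oo)%E)
  (* the batch size *)
  (alpha : R) (alpha_gt0 : 0 < alpha)
  (Hn : forall k, (alpha%:E * ((gamma k)%:E / (zeta (gamma k))%:E) ^+ 2
                   <= (n k)%:R%:E)%E) :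
  let S := history (x 0%N) (mu 0%N) s in
  (forall k, exists Y, is_cond_expectation P (S k) (fun w => `|lam k.+1 w|) Y) /\
  (forall Y : nat -> T -> R,
     (forall k, is_cond_expectation P (S k) (fun w => `|lam k.+1 w|) (Y k)) ->
     in_l1 P S (fun k w => gamma k.+1 * Y k w)).
Proof.
move=> S.
have [r Cr] := weakly_compact_bounded ip Hip C Ccomp.
have [c0 Cc0 fin2] := HL2.
have gL_omega e c c' : `|gL c e - gL c' e| <= omega `|c - c'|.
  exact: (HE2 e).2.
have [q [mq gLq errq iq]] := gradient_error_envelope ip Hip P eta C gL gradf
  omega r Cr HE1 gLmeas gL_omega omega_nd c0 Cc0 fin2.
pose M := fine (\int[P]_w (q (eta w) ^+ 2)%:E)%E.
have qM : (\int[P]_w (q (eta w) ^+ 2)%:E = M%:E)%E.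
  by rewrite fineK // integrable_fin_num.
have M0 : 0 <= M.
  by apply/fine_ge0/integral_ge0 => w _; rewrite lee_fin sqr_ge0.
have xC := iterate_in x s gamma Hx C Cconv Hgamma x0C sC.
have step k : [/\ 0 < zeta (gamma k), (0 < n k)%N &
    alpha * gamma k ^+ 2 <= (n k)%:R * zeta (gamma k) ^+ 2].
  have /andP[g0 _] := Hgamma k.
  exact: batch_size_step alpha_gt0 g0 (zeta_ge0 _ (Hgamma k)) (Hn k).
pose F := history_gen x (mu 0%N) s.
have FM k : F k `<=` measurable by exact: history_gen_measurable.
have xi_pair k (i j : 'I_(n k)) :
    i != j -> independent_maps P (xi k i) (xi k j).
  move=> ij.
  pose i' : {k : nat & 'I_(n k)} := Tagged (fun k => 'I_(n k)) i.
  pose j' : {k : nat & 'I_(n k)} := Tagged (fun k => 'I_(n k)) j.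
  have ij' : i' != j' by rewrite /i' /j' eq_Tagged.
  exact: (mutually_independent_pair P _ (fun j : {k : nat & 'I_(n k)} =>
    xi (tag j) (tagged j)) xi_indep i' j' ij').
have lamE k w : lam k.+1 w = (n k.+1)%:R^-1 *:
    (\sum_(i < n k.+1) gL (x k.+1 w) (xi k.+1 i w)) - gradf (x k.+1 w).
  by rewrite Hlam Hhatgrad.
have xmeas k := iterate_strongly_measurable x (mu 0%N) s gamma x0meas smeas Hx
  k k.+1 (leqnn _).
have nk k : (0 < n k)%N by have [] := step k.
have bound k t B := fresh_batch_error ip Hip P eta C L gL gradf Lmeas HgL HE1
  gLmeas q M mq gLq errq iq qM (F k) (n k.+1) (xi k.+1) (FM k) (xi_fresh k)
  (xi_id k.+1) (xi_pair k.+1) (x k.+1) (xmeas k) (xC k.+1) (hatmeas k.+1)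
  (gradfmeas k.+1) (nk k.+1) t B.
have lam_int k : P.-integrable setT (EFin \o (fun w => `|lam k.+1 w|)).
  rewrite /comp; under eq_fun do rewrite lamE.
  exact: (fresh_batch_integrable ip Hip P eta C L gL gradf Lmeas HgL HE1
  gLmeas q M mq gLq errq iq qM (F k) (n k.+1) (xi k.+1) (FM k) (xi_fresh k)
  (xi_id k.+1) (xi_pair k.+1) (x k.+1) (xmeas k) (xC k.+1) (hatmeas k.+1)
  (gradfmeas k.+1) (nk k.+1)).
split=> [k|Y YE]; first exact: cond_expectation_exists (FM k) (lam_int k).
(* With this K one has M <= alpha * K <= alpha * K ^ 2, so t k satisfies
   M <= n k * t k ^ 2. *)
pose K := 1 + M / alpha.
have K0 : 0 < K by rewrite ltr_pwDl // divr_ge0 // ltW.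
pose t k := K * zeta (gamma k) / gamma k.
have t0 k : 0 < t k.
  have [z0 _ _] := step k; have /andP[g0 _] := Hgamma k.
  by rewrite divr_gt0 // mulr_gt0.
have Mt k : M <= (n k)%:R * t k ^+ 2.
  have [z0 _ nz] := step k; have /andP[g0 _] := Hgamma k.
  have -> : (n k)%:R * t k ^+ 2 =
      K ^+ 2 * ((n k)%:R * zeta (gamma k) ^+ 2) / gamma k ^+ 2.
    by rewrite /t; field; rewrite gt_eqF.
  rewrite ler_pdivlMr ?exprn_gt0 //.
  apply: (@le_trans _ _ (K ^+ 2 * (alpha * gamma k ^+ 2))); last first.
    by rewrite ler_wpM2l // exprn_ge0 // ltW.
  rewrite [K ^+ 2 * _]mulrA ler_wpM2r ?sqr_ge0 //.
  have MK : M <= K * alpha.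
    by rewrite /K mulrDl divfK ?gt_eqF // mul1r lerDr ltW.
  rewrite (le_trans MK) // ler_wpM2r ?(ltW alpha_gt0) // expr2.
  rewrite ler_peMr ?(ltW K0) //.
  by rewrite /K lerDl divr_ge0 // ltW.
have Yt k : {ae P, forall w, `|Y k w| <= t k.+1}.
  apply: cond_expectation_bounded (FM k) (YE k) _ _ => // B FB.
  by under eq_integral do rewrite lamE; exact: bound.
split=> [k B mB|].
  have [_ _ mY _] := YE k.
  apply: (mY ((fun y => gamma k.+1 * y) @^-1` B)).
  have mg : measurable_fun setT (fun y : R => gamma k.+1 * y).
    exact: measurable_funM.
  by have := mg measurableT B mB; rewrite setTI.
apply: filterS (ae_foralln Yt) => w Yw.
apply: series_le_cvg (cvgn_series_shift (fun k => zeta (gamma k)) K Hzeta).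
- by move=> k.
- by move=> k; rewrite mulr_ge0 ?(ltW K0) // zeta_ge0.
- move=> k; have /andP[g0 _] := Hgamma k.+1.
  rewrite normrM gtr0_norm // (le_trans (ler_wpM2l (ltW g0) (Yw k))) //.
  by rewrite /t mulrC divfK // gt_eqF.
Qed.
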